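(* Let $m\ge 4$. The Zariski closure of the boundary of the cone $\mathcal{C}_m$ is defined by the polynomial $$H_{C_m}(s_{ij})=\Gamma_m(s_{ij})\cdot(s_{11}s_{22}-s_{12}^2)\cdot(s_{22}s_{33}-s_{23}^2)\cdots(s_{mm}s_{11}-s_{1m}^2).$$
   Context: $C_m$ is the chordless $m$-cycle with vertices $1,\dots,m$ and edges $\{i,i+1\}$ (indices modulo $m$). The cone $\mathcal{C}_m\subset\mathbb{R}^{2m}$ is the set of partial symmetric $m\times m$-matrices, with specified entries $s_{11},s_{22},\dots,s_{mm}$ and $s_{12},s_{23},\dots,s_{m-1,m},s_{1m}=s_{m1}$, that can be completed to a positive definite symmetric $m\times m$-matrix. It is an open convex cone with boundary $\overline{\mathcal{C}_m}\setminus\mathcal{C}_m$. The $m$-th cycle polynomial $\Gamma'_m\in\mathbb{R}[x_1,\dots,x_m]$ is the unique (up to scaling) irreducible polynomial obtained by rationalizing the equation $$x_1=\cos\Bigl(\sum_{i=2}^m\arccos(x_i)\Bigr),$$ i.e. the irreducible polynomial vanishing on the hypersurface in $[-1,1]^m$ defined by this equation (obtained by expanding with the cosine sum formula and $\sin(\arccos(x_i))=\sqrt{1-x_i^2}$, and eliminating the square roots). The homogeneous $m$-th cycle polynomial $\Gamma_m$ is the numerator of the expression obtained from $\Gamma'_m$ by the substitution $$x_i=\frac{s_{i,i+1}}{\sqrt{s_{ii}\,s_{i+1,i+1}}}\qquad(i=1,\dots,m,\ \text{indices modulo } m).$$ For example, $\Gamma_3$ is the determinant of the generic symmetric $3\times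 3$-matrix. *)

(* Defs.v *)
From HB Require Import structures.
From mathcomp Require Import all_boot all_order all_algebra.
From mathcomp Require Import all_classical all_reals all_analysis.
From mathcomp Require mpoly.
Import (canonicals, coercions) mpoly.

Set Implicit Arguments.
Unset Strict Implicit.
Unset Printing Implicit Defensive.

Import Order.TTheory GRing.Theory Num.Theory.
Import numFieldNormedType.Exports.

Local Open Scope classical_set_scope.
Local Open Scope ring_scope.

(* The notations of mpoly clash with those of MathComp-Analysis, so it is only
   partially imported. *)
Notation mvpoly n R := (mpoly.mpoly n R).
Notation mvar R i := (@mpoly.mpolyX _ R (mpoly.mnm1 i)).

Section Polynomials.
Variables (R : realType) (n : nat).
Implicit Types (p q d : mvpoly n R) (S : set 'rV[R]_n).

Definition peval p (x : 'rV[R]_n) : R := mpoly.meval (fun i => x ord0 i) p.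

Definition pdivides d p : Prop := exists q, p = q * d.

Definition pirreducible p : Prop :=
  [/\ p != 0, p \isn't a GRing.unit &
      forall a b, p = a * b -> a \is a GRing.unit \/ b \is a GRing.unit].

Definition pcoprime p q : Prop :=
  forall d, pdivides d p -> pdivides d q -> d \is a GRing.unit.

Definition zero_locus p : set 'rV[R]_n := [set x | peval p x = 0].

Definition vanishing_ideal S : set (mvpoly n R) :=
  [set p | forall x, S x -> peval p x = 0].

Definition principal_ideal p : set (mvpoly n R) := [set q | pdivides p q].

Definition zariski_closure S : set 'rV[R]_n :=
  [set x | forall p, vanishing_ideal S p -> peval p x = 0].

(* The second clause excludes polynomials such as p ^+ 2 or p * (1 + X ^+ 2),
   which have the same real zeros as p; it also makes p define the Zariski
   closure over the complex numbers. *)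
Definition zariski_closure_defined_by S p : Prop :=
  zariski_closure S = zero_locus p /\ vanishing_ideal S = principal_ideal p.

End Polynomials.

Definition posdefmx (R : realType) (m : nat) (X : 'M[R]_m) : Prop :=
  X^T = X /\ forall v : 'rV[R]_m, v != 0 -> 0 < (v *m X *m v^T) ord0 ord0.

(* Vertices are numbered from 0.  A partial matrix s is a point of R^(m + m):
   its first m coordinates are the diagonal entries s_ii, and its last m
   coordinates the entries s_{i,i+1}, with ordS the successor modulo m. *)
Definition dg (m : nat) (i : 'I_m) : 'I_(m + m) := lshift m i.
Definition eg (m : nat) (i : 'I_m) : 'I_(m + m) := rshift m i.

Definition cycle_cone (R : realType) (m : nat) : set 'rV[R]_(m + m) :=
  [set s | exists X : 'M[R]_m, posdefmx X /\
     forall i : 'I_m, X i i = s ord0 (dg i) /\ X i (ordS i) = s ord0 (eg i)].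

Definition cycle_cone_boundary (R : realType) (m : nat) : set 'rV[R]_(m + m) :=
  closure (@cycle_cone R m) `\` @cycle_cone R m.

(* i0 is the first index, so this is x_1 = cos (\sum_(i >= 2) acos x_i). *)
Definition cycle_hypersurface (R : realType) (m : nat) : set 'rV[R]_m :=
  [set x | (forall i, -1 <= x ord0 i <= 1) /\
     forall i0 : 'I_m, val i0 = 0%N ->
       x ord0 i0 = cos (\sum_(i < m | i != i0) acos (x ord0 i))].

(* Determines the polynomial up to a nonzero scalar. *)
Definition is_cycle_polynomial (R : realType) (m : nat) (G' : mvpoly m R) : Prop :=
  pirreducible G' /\ vanishing_ideal (@cycle_hypersurface R m) G'.

Definition cycle_subst (R : realType) (m : nat) (s : 'rV[R]_(m + m)) : 'rV[R]_m :=
  \row_i (s ord0 (eg i) / Num.sqrt (s ord0 (dg i) * s ord0 (dg (ordS i)))).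

(* G is the numerator, in lowest terms, of the rational function G / Q which
   agrees with G' after the substitution, wherever all s_ii are positive. *)
Definition is_homogeneous_cycle_polynomial (R : realType) (m : nat)
    (G : mvpoly (m + m) R) : Prop :=
  exists G' : mvpoly m R, is_cycle_polynomial G' /\
  exists Q : mvpoly (m + m) R, [/\ Q != 0, pcoprime G Q &
    forall s : 'rV[R]_(m + m), (forall i : 'I_m, 0 < s ord0 (dg i)) ->
      peval G s = peval Q s * peval G' (cycle_subst s)].

Definition edge_minor (R : realType) (m : nat) (i : 'I_m) : mvpoly (m + m) R :=
  mvar R (dg i) * mvar R (dg (ordS i)) - mvar R (eg i) ^+ 2.

Definition cycle_boundary_polynomial (R : realType) (m : nat)
    (G : mvpoly (m + m) R) : mvpoly (m + m) R :=
  G * \prod_(i < m) edge_minor R i.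

(* Main.v *)
(* Normalising the diagonal to 1, a partial matrix on the cycle is given by
   angles theta_i = arccos x_i, and a positive semidefinite completion is a
   closed chain of unit vectors with these consecutive angles.

   If some three consecutive vectors of such a chain are independent, then
   moving the vectors one after the other around the cycle, each one into a new
   dimension while keeping its angles with its two neighbours, makes the whole
   chain independent.  Hence at a boundary point where no edge minor vanishes
   the chain is planar, so that x_1 = cos (sum of signed angles), and the cycle
   polynomial vanishes there by analytic continuation in the angles.

   Conversely, let P vanish on the boundary.  Contracting an edge produces
   enough boundary points on each edge minor, and this minor divides P.
   Strict triangle inequalities show that the planar chains with
   theta_1 = theta_2 + ... + theta_m are boundary points; by analytic
   continuation P vanishes wherever x_1 is one of the 2 ^ (m - 2) values
   cos (theta_2 +- theta_3 +- ... +- theta_m).  These values are generically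
   distinct and are the roots of a monic polynomial in x_1 (a characteristic
   polynomial), which therefore divides P, and which is the cycle polynomial up
   to a scalar.  After homogenisation this only holds up to monomials in the
   s_ii, which are prime and do not divide Gamma_m. *)

Require Import Defs.
From mathcomp Require Import all_boot all_order all_algebra.
From mathcomp Require Import all_classical all_reals all_analysis.
From mathcomp Require Import ring lra zify.
From mathcomp Require mpoly.
Import (canonicals, coercions) mpoly.

Set Implicit Arguments.
Unset Strict Implicit.
Unset Printing Implicit Defensive.

Import Order.TTheory GRing.Theory Num.Theory.
Import numFieldNormedType.Exports.

Local Open Scope ring_scope.

(** * Polynomial functions *)

Section RealPolynomials.
Variable R : realType.
Implicit Types (p q : {poly R}).

Lemma poly_infinite_roots0 p (f : nat -> R) :
  injective f -> (forall k, p.[f k] = 0) -> p = 0.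
Proof.
move=> f_inj pf0; apply: (@roots_geq_poly_eq0 _ p [seq f k | k <- iota 0 (size p)]).
- by apply/allP => _ /mapP[k _ ->]; rewrite rootE pf0.
- by rewrite map_inj_uniq ?iota_uniq.
- by rewrite size_map size_iota.
Qed.

Lemma poly_itv0 p (a b : R) :
  a < b -> (forall x, a <= x <= b -> p.[x] = 0) -> p = 0.
Proof.
move=> ltab p0; pose f (k : nat) := a + (b - a) / k.+1%:R.
have ba : 0 < b - a by rewrite subr_gt0.
apply: (@poly_infinite_roots0 _ f).
  move=> k l /addrI /(mulfI (lt0r_neq0 ba)) /invr_inj /eqP.
  by rewrite eqr_nat => /eqP[].
move=> k; apply: p0; rewrite lerDl divr_ge0 ?ler0n ?(ltW ba) //=.
rewrite -lerBrDl ler_pdivrMr ?ltr0n // ler_peMr ?(ltW ba) //.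
by rewrite ler1n.
Qed.

End RealPolynomials.

Section PolynomialFunctions.
Variables (R : realType) (n : nat).
Implicit Types (p q : mvpoly n R) (x y : 'rV[R]_n) (v : 'I_n).

(** Serves to compare two ring morphisms, or evaluations, on constants and variables only. *)
Lemma mvpoly_ind (K : mvpoly n R -> Prop) :
  (forall c, K (mpoly.mpolyC n c)) -> (forall i, K (mvar R i)) ->
  (forall p q, K p -> K q -> K (p + q)) ->
  (forall p q, K p -> K q -> K (p * q)) -> forall p, K p.
Proof.
move=> KC KX KD KM p; rewrite (mpoly.mpolyE p).
apply: (big_ind K) => //; first by rewrite -(mpoly.mpolyC0 n).
move=> m _; rewrite -mpoly.mul_mpolyC; apply: (KM) => //.
rewrite mpoly.mpolyXE_id; apply: (big_ind K) => //.
  by rewrite -(mpoly.mpolyC1 n).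
move=> i _; elim: (mpoly.fun_of_multinom m i) => [|k IH].
  by rewrite expr0 -(mpoly.mpolyC1 n).
by rewrite exprS; apply: (KM).
Qed.

Lemma pe_exists x : {f : {rmorphism mvpoly n R -> R} | forall p, f p = peval p x}.
Proof. by exists (mpoly.meval (fun i => x ord0 i) : {rmorphism _ -> _}). Qed.

(* [peval p x] as a morphism; it is kept opaque because unifying two instances
   of the underlying sum is very slow. *)
Definition pe x : {rmorphism mvpoly n R -> R} := sval (pe_exists x).

Lemma peE x p : pe x p = peval p x.
Proof. exact: (svalP (pe_exists x)). Qed.

Lemma peC x c : pe x (mpoly.mpolyC n c) = c.
Proof. by rewrite peE; apply: mpoly.mevalC. Qed.

Lemma peX x i : pe x (mvar R i) = x ord0 i.
Proof. by rewrite peE; apply: mpoly.mevalXU. Qed.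

Definition upd v (w : R) y : 'rV[R]_n := \row_i (if i == v then w else y ord0 i).

Lemma updE v w y i : upd v w y ord0 i = if i == v then w else y ord0 i.
Proof. by rewrite mxE. Qed.

Lemma upd_same v y : upd v (y ord0 v) y = y.
Proof. by apply/rowP => i; rewrite updE; case: eqP => [->|]. Qed.

Lemma in_var_exists v : {f : {rmorphism mvpoly n R -> {poly mvpoly n R}} |
  (forall c, f (mpoly.mpolyC n c) = (mpoly.mpolyC n c)%:P) /\
  (forall i, f (mvar R i) = if i == v then 'X else (mvar R i)%:P)}.
Proof.
exists (mpoly.mmap (polyC \o @mpoly.mpolyC n R)
             (fun i => if i == v then 'X else (mvar R i)%:P) : {rmorphism _ -> _}).
by split=> [c|i] /=; rewrite ?mpoly.mmapC // mpoly.mmapX mpoly.mmap1U.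
Qed.

(* The variables other than [v] remain in the coefficients. *)
Definition in_var v : {rmorphism mvpoly n R -> {poly mvpoly n R}} := sval (in_var_exists v).

Lemma in_varC v c : in_var v (mpoly.mpolyC n c) = (mpoly.mpolyC n c)%:P.
Proof. exact: (svalP (in_var_exists v)).1. Qed.

Lemma in_varX v i : in_var v (mvar R i) = if i == v then 'X else (mvar R i)%:P.
Proof. exact: (svalP (in_var_exists v)).2. Qed.

Lemma horner_in_var v p : (in_var v p).[mvar R v] = p.
Proof.
elim/mvpoly_ind: p => [c|i|p q IHp IHq|p q IHp IHq].
- by rewrite in_varC hornerC.
- by rewrite in_varX; case: eqP => [->|_]; rewrite ?hornerX ?hornerC.
- by rewrite rmorphD hornerD IHp IHq.
- by rewrite rmorphM hornerM IHp IHq.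
Qed.

(** Restricts [p] to the line through [y] parallel to the axis [v], which reduces vanishing and
    divisibility questions to one real variable. *)
Lemma horner_map_in_var v y w p : (map_poly (pe y) (in_var v p)).[w] = pe (upd v w y) p.
Proof.
elim/mvpoly_ind: p => [c|i|p q IHp IHq|p q IHp IHq].
- by rewrite in_varC map_polyC hornerC /= !peC.
- rewrite in_varX peX updE; case: eqP => _; first by rewrite map_polyX hornerX.
  by rewrite map_polyC hornerC /= peX.
- by rewrite !rmorphD hornerD IHp IHq.
- by rewrite !rmorphM hornerM IHp IHq.
Qed.

End PolynomialFunctions.
Arguments in_var {R n} v.

(** * Polynomials vanishing on boxes *)

Section Vanishing.
Variable R : realType.

(** Uniqueness of base [b] expansions; it keeps distinct monomials distinct under the Kronecker
    substitution. *)
Lemma base_digits_inj (n b : nat) (m1 m2 : 'I_n -> nat) :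
  (forall i, m1 i < b)%N -> (forall i, m2 i < b)%N ->
  (\sum_i m1 i * b ^ i = \sum_i m2 i * b ^ i)%N -> m1 =1 m2.
Proof.
elim: n m1 m2 => [m1 m2 _ _ _ []//|n IH m1 m2 lt1 lt2].
have b0 : (0 < b)%N by apply: leq_ltn_trans (lt1 ord0).
have shift (m : 'I_n.+1 -> nat) :
    (\sum_i m i * b ^ i = (\sum_(i < n) m (lift ord0 i) * b ^ i) * b + m ord0)%N.
  rewrite big_ord_recl /= expn0 muln1 addnC big_distrl /=; congr addn.
  by apply: eq_bigr => i _; rewrite /bump /= add1n expnSr mulnA.
rewrite !shift => E.
have E0 : m1 ord0 = m2 ord0.
  by have /(congr1 (modn^~ b)) := E; rewrite /= !modnMDl !modn_small.
have {}E := addIn (etrans E (congr1 (addn _) (esym E0))).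
have {}E : (\sum_(i < n) m1 (lift ord0 i) * b ^ i = \sum_(i < n) m2 (lift ord0 i) * b ^ i)%N.
  by apply/eqP; rewrite -(eqn_pmul2r b0) E.
move=> i; have [j ->|->] := unliftP ord0 i; last exact: E0.
exact: (IH (fun j => m1 (lift ord0 j)) (fun j => m2 (lift ord0 j)) _ _ E j).
Qed.

(* Kronecker substitution [x_i := t ^ (b ^ i)], with [b] above the degree. *)
Lemma pe_eq0 (n : nat) (p : mvpoly n R) : (forall x, pe x p = 0) -> p = 0.
Proof.
move=> p0; pose b := mpoly.msize p.
pose deg (m : mpoly.multinom n) := (\sum_i mpoly.fun_of_multinom m i * b ^ i)%N.
pose q : {poly R} := \sum_(m <- mpoly.msupp p) mpoly.mcoeff m p *: 'X^(deg m).
have q0 : q = 0.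
  apply: (@poly_itv0 _ _ 0 1) => // w _; rewrite -(p0 (\row_i w ^+ (b ^ i))).
  rewrite peE /peval mpoly.mevalE horner_sum; apply: eq_bigr => m _.
  rewrite hornerZ hornerXn expr_sum; congr (_ * _).
  by apply: eq_bigr => i _; rewrite mxE -exprM mulnC.
apply/mpoly.mpolyP => m; rewrite mpoly.mcoeff0.
have [mp|] := boolP (m \in mpoly.msupp p); last exact: mpoly.memN_msupp_eq0.
have /(congr1 (coefp (deg m))) := q0; rewrite /q /= coef0 coef_sum => qm.
rewrite -qm (bigD1_seq m) ?mpoly.msupp_uniq //= coefZ coefXn eqxx mulr1.
rewrite big_seq_cond big1 ?addr0 // => m' /andP[m'p neq].
rewrite coefZ coefXn; case: eqP => [E|]; last by rewrite mulr0.
have ltb (r : mpoly.multinom n) : r \in mpoly.msupp p ->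
    forall i, (mpoly.fun_of_multinom r i < b)%N.
  move=> /mpoly.msize_mdeg_lt rp i; apply: leq_ltn_trans rp.
  by rewrite mpoly.mdegE (bigD1 i) //= leq_addr.
case/eqP: neq; apply/mpoly.mnmP => i.
exact: (base_digits_inj (ltb _ m'p) (ltb _ mp) (esym E) i).
Qed.

Lemma pe_box_eq0 (n : nat) (p : mvpoly n R) (a b : 'I_n -> R) :
  (forall i, a i < b i) ->
  (forall x : 'rV[R]_n, (forall i, a i <= x ord0 i <= b i) -> pe x p = 0) -> p = 0.
Proof.
move=> ltab p0; apply: pe_eq0 => x.
(* [s] lists the coordinates already released from the box. Each induction step releases one more,
   by a polynomial in one variable that vanishes on an interval. *)
have free (s : seq 'I_n) : forall x : 'rV[R]_n,
    (forall i, i \notin s -> a i <= x ord0 i <= b i) -> pe x p = 0.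
  elim: s => [y yab|v s IH y yab]; first by apply: p0 => i; apply: yab.
  suff q0 : map_poly (pe y) (in_var v p) = 0.
    by rewrite -(upd_same v y) -horner_map_in_var q0 horner0.
  apply: (poly_itv0 (ltab v)) => w wab; rewrite horner_map_in_var.
  apply: IH => i si; rewrite updE; case: eqP => [->//|/eqP iv].
  by apply: yab; rewrite inE negb_or iv.
by apply: (free (enum 'I_n)) => i; rewrite mem_enum.
Qed.

Lemma pe_box_neq0 (n : nat) (p : mvpoly n R) (a b : 'I_n -> R) :
  (forall i, a i < b i) -> p != 0 ->
  exists x : 'rV[R]_n, (forall i, a i <= x ord0 i <= b i) /\ pe x p != 0.
Proof.
move=> ltab /eqP pN0; apply: contrapT => none; apply: pN0.
apply: (pe_box_eq0 ltab) => x xab; apply: contrapT => /eqP px.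
by apply: none; exists x.
Qed.

Lemma pe_horner (n : nat) (P : {poly mvpoly n R}) (y : 'rV[R]_n) q :
  pe y P.[q] = (map_poly (pe y) P).[pe y q].
Proof. by rewrite horner_map. Qed.

Lemma unit_const (n : nat) (u : mvpoly n R) : u \is a GRing.unit ->
  exists2 c, c != 0 & u = mpoly.mpolyC n c.
Proof.
move=> /[dup] uU /andP[/eqP uE _]; eexists; last exact: uE.
by apply: contraTneq uU => E; rewrite uE E mpoly.mpolyC0 unitr0.
Qed.

End Vanishing.

Section Subst.
Variables (R : realType) (n k : nat).

Lemma psubst_exists (h : 'I_n -> mvpoly k R) : {f : {rmorphism mvpoly n R -> mvpoly k R} |
  (forall c, f (mpoly.mpolyC n c) = mpoly.mpolyC k c) /\ (forall i, f (mvar R i) = h i)}.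
Proof.
exists (mpoly.mmap (@mpoly.mpolyC k R) h : {rmorphism _ -> _}).
by split=> [c|i] /=; rewrite ?mpoly.mmapC // mpoly.mmapX mpoly.mmap1U.
Qed.

Definition psubst h : {rmorphism mvpoly n R -> mvpoly k R} := sval (psubst_exists h).

Lemma psubstC h c : psubst h (mpoly.mpolyC n c) = mpoly.mpolyC k c.
Proof. exact: (svalP (psubst_exists h)).1. Qed.

Lemma psubstX h i : psubst h (mvar R i) = h i.
Proof. exact: (svalP (psubst_exists h)).2. Qed.

Lemma pe_psubst h p x : pe x (psubst h p) = pe (\row_i pe x (h i)) p.
Proof.
elim/mvpoly_ind: p => [c|i|p q IHp IHq|p q IHp IHq].
- by rewrite psubstC !peC.
- by rewrite psubstX peX mxE.
- by rewrite !rmorphD IHp IHq.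
- by rewrite !rmorphM IHp IHq.
Qed.

End Subst.

Section Rescaling.

(** This is [d ^+ n * p (X / d)], written without division; it multiplies the roots of [p] by
    [d]. *)
Definition rescale (A : comNzRingType) (n : nat) (d : A) (p : {poly A}) : {poly A} :=
  \poly_(k < n) (d ^+ (n - k) * p`_k).

Lemma horner_rescale (A : comNzRingType) n (d w : A) (p : {poly A}) : (size p <= n)%N ->
  (rescale n d p).[d * w] = d ^+ n * p.[w].
Proof.
move=> pn; rewrite horner_poly (horner_coef_wide _ pn) mulr_sumr; apply: eq_bigr => k _.
have -> : d ^+ n = d ^+ (n - k) * d ^+ k by rewrite -exprD subnK // ltnW.
by rewrite exprMn; ring.
Qed.

Lemma map_rescale (A B : comNzRingType) (f : {rmorphism A -> B}) n d (p : {poly A}) :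
  map_poly f (rescale n d p) = rescale n (f d) (map_poly f p).
Proof.
apply/polyP => k; rewrite coef_map /rescale [in LHS]coef_poly [in RHS]coef_poly /=.
case: ifP => kn; last by rewrite rmorph0.
by rewrite rmorphM rmorphXn /= -coef_map.
Qed.

End Rescaling.

(** * Divisibility by a monic polynomial, tested on its roots *)

Section MonicDivision.
Variables (R : realType) (n : nat).
Implicit Types (p q : mvpoly n R) (y : 'rV[R]_n).

(* At each point of [Y] the remainder of the division has too many roots. *)
Lemma monic_dvd (T P : {poly mvpoly n R}) (Y : 'rV[R]_n -> Prop) (rs : 'rV[R]_n -> seq R) :
  T \is monic ->
  (forall q, (forall y, Y y -> pe y q = 0) -> q = 0) ->
  (forall y, Y y -> [/\ uniq (rs y), ((size T).-1 <= size (rs y))%N &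
     forall z, z \in rs y -> (map_poly (pe y) T).[z] = 0 /\ (map_poly (pe y) P).[z] = 0]) ->
  exists K, P = K * T.
Proof.
move=> Tmon Ydense YP; exists (Pdiv.Ring.rdivp P T).
have divE := Pdiv.RingMonic.rdivp_eq Tmon P; set r := Pdiv.Ring.rmodp P T in divE.
suff r0 : r = 0 by rewrite {1}divE r0 addr0.
apply/polyP => i; rewrite coef0; apply: Ydense => y yY.
have [rs_uniq rs_size rsP] := YP y yY.
have size_r : (size (map_poly (pe y) r) <= size (rs y))%N.
  apply: leq_trans rs_size; apply: (leq_trans (size_poly _ _)).
  rewrite -ltnS prednK ?lt0n ?size_poly_eq0 ?monic_neq0 //.
  by rewrite Pdiv.Ring.ltn_rmodp monic_neq0.
have ry0 : map_poly (pe y) r = 0.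
  apply: (roots_geq_poly_eq0 _ rs_uniq size_r).
  apply/allP => z /rsP[Tz Pz]; rewrite rootE; move: Pz.
  by rewrite divE rmorphD rmorphM hornerD hornerM Tz mulr0 add0r => ->.
by rewrite -coef_map ry0 coef0.
Qed.

End MonicDivision.

(** * Cosines of sums of angles *)

Section TrigonometricPolynomials.
Variable R : realType.
Implicit Types (f g : R -> R).

(** The normal form of a trigonometric polynomial after reducing the powers of [sin t] by
    [sin ^+ 2 = 1 - cos ^+ 2]. *)
Definition trig_poly f :=
  exists A B : {poly R}, forall t, f t = A.[cos t] + sin t * B.[cos t].

Lemma trig_polyC (c : R) : trig_poly (fun=> c).
Proof. by exists c%:P, 0 => t; rewrite hornerC horner0 mulr0 addr0. Qed.

Lemma trig_polyD f g : trig_poly f -> trig_poly g -> trig_poly (fun t => f t + g t).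
Proof.
move=> [A [B fE]] [A' [B' gE]]; exists (A + A'), (B + B') => t.
by rewrite fE gE !hornerD; ring.
Qed.

Lemma trig_polyM f g : trig_poly f -> trig_poly g -> trig_poly (fun t => f t * g t).
Proof.
move=> [A [B fE]] [A' [B' gE]].
exists (A * A' + (1 - 'X ^+ 2) * B * B'), (A * B' + B * A') => t.
rewrite fE gE !hornerE -sin2cos2.
by ring.
Qed.

Lemma trig_poly_cosD (a : R) : trig_poly (fun t => cos (a + t)).
Proof.
exists (cos a *: 'X), (- sin a)%:P => t.
by rewrite cosD hornerZ hornerX hornerC; ring.
Qed.

Lemma trig_poly_pe n (x : R -> 'rV[R]_n) (p : mvpoly n R) :
  (forall i, trig_poly (fun t => x t ord0 i)) -> trig_poly (fun t => pe (x t) p).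
Proof.
have ext f g : f =1 g -> trig_poly g -> trig_poly f.
  by move=> fg [A [B gE]]; exists A, B => t; rewrite fg.
move=> xt; elim/mvpoly_ind: p => [c|i|p q IHp IHq|p q IHp IHq].
- by apply: ext (trig_polyC c) => t; rewrite peC.
- by apply: ext (xt i) => t; rewrite peX.
- by apply: ext (trig_polyD IHp IHq) => t; rewrite rmorphD.
- by apply: ext (trig_polyM IHp IHq) => t; rewrite rmorphM.
Qed.

Lemma ler_cos (x y : R) : 0 <= x <= pi -> 0 <= y <= pi -> (cos x <= cos y) = (y <= x).
Proof. by move=> x0 y0; rewrite !leNgt ltr_cos ?in_itv. Qed.

(* From [A(c) + s B(c) = 0] follows the polynomial identity
   [A^2 = (1 - X^2) B^2], whose sides have opposite signs beyond [1]. *)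
Lemma trig_poly_itv0 f (a b : R) : 0 <= a -> a < b -> b <= pi ->
  trig_poly f -> (forall t, a <= t <= b -> f t = 0) -> forall t, f t = 0.
Proof.
move=> a0 ltab bpi [A [B fE]] f0.
have E0 : A ^+ 2 - (1 - 'X ^+ 2) * B ^+ 2 = 0.
  apply: (@poly_itv0 _ _ (cos b) (cos a)).
    by rewrite ltr_cos ?in_itv /= ?a0 ?bpi ?(le_trans a0 (ltW ltab)) ?(le_trans (ltW ltab) bpi).
  move=> x xab; have x1 : -1 <= x <= 1.
    by case/andP: xab => bx xa; rewrite (le_trans (cos_geN1 b) bx) (le_trans xa (cos_le1 a)).
  have tab : a <= acos x <= b.
    have ab_pi : [/\ 0 <= a <= pi, 0 <= b <= pi & 0 <= acos x <= pi].
      by rewrite a0 bpi acos_ge0 ?acos_lepi ?(le_trans a0 (ltW ltab)) ?(le_trans (ltW ltab) bpi).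
    case: ab_pi => api bpi' xpi.
    by rewrite -(ler_cos xpi api) -(ler_cos bpi' xpi) acosK ?in_itv //= andbC.
  have := f0 _ tab; rewrite fE acosK ?in_itv //= => AB.
  rewrite !hornerE.
  have := sin2cos2 (acos x); rewrite acosK ?in_itv //= => s2.
  move: AB => /eqP; rewrite addr_eq0 => /eqP ->.  rewrite -s2; ring.
have AB x : A.[x] ^+ 2 = (1 - x ^+ 2) * B.[x] ^+ 2.
  have /(congr1 (fun p => p.[x])) := E0.
  rewrite !hornerE => /eqP.
  by rewrite subr_eq0 => /eqP.
have neg (x : R) : 2 <= x <= 3 -> 1 - x ^+ 2 < 0 by move=> /andP[x2 x3]; nra.
have A0 : A = 0.
  apply: (@poly_itv0 _ _ 2 3) => [|x x23]; first by lra.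
  apply/eqP; rewrite -sqrf_eq0 eq_le sqr_ge0 andbT AB.
  by rewrite mulr_le0_ge0 ?sqr_ge0 // ltW ?neg.
have B0 : B = 0.
  apply: (@poly_itv0 _ _ 2 3) => [|x x23]; first by lra.
  have /esym/eqP := AB x; rewrite A0 horner0 expr0n /= mulf_eq0 sqrf_eq0.
  by rewrite (negbTE (ltr0_neq0 (neg x x23))) => /eqP.
by move=> t; rewrite fE A0 B0 !horner0 mulr0 addr0.
Qed.

(** The form of analytic continuation used for angles: coordinates are released from the box one at
    a time, as for polynomials. *)
Lemma trig_poly_box0 n (F : 'rV[R]_n -> R) (a b : 'I_n -> R) :
  (forall i, [/\ 0 <= a i, a i < b i & b i <= pi]) ->
  (forall x i, trig_poly (fun t => F (upd i t x))) ->
  (forall x : 'rV[R]_n, (forall i, a i <= x ord0 i <= b i) -> F x = 0) -> forall x, F x = 0.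
Proof.
move=> ab Ft F0 x.
have free (s : seq 'I_n) : forall x : 'rV[R]_n,
    (forall i, i \notin s -> a i <= x ord0 i <= b i) -> F x = 0.
  elim: s => [y yab|v s IH y yab]; first by apply: F0 => i; apply: yab.
  have [a0 ltab bpi] := ab v.
  rewrite -(upd_same v y); apply: (trig_poly_itv0 a0 ltab bpi (Ft y v)) => w wab.
  apply: IH => i si; rewrite updE; case: eqP => [->//|/eqP iv].
  by apply: yab; rewrite inE negb_or iv.
by apply: (free (enum 'I_n)) => i; rewrite mem_enum.
Qed.

End TrigonometricPolynomials.

(** * The monic polynomial whose roots are the cosines of signed sums *)

Section CosineOfSums.
Variables (R : realType) (I : eqType).

(** This recursion makes [dbl k.+1] convertible to a sum, as the type of a two by two block matrix
    requires. *)
Fixpoint dbl k := if k is k'.+1 then (dbl k' + dbl k')%N else 1%N.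

Lemma dblE k : dbl k = (2 ^ k)%N.
Proof. by elim: k => //= k ->; rewrite expnS mul2n addnn. Qed.

(* The matrix is built from iterated companion blocks of the quadratic equation
   satisfied by [rho sigma cos (A + B)] over [Z = rho cos A],
   [e = sigma cos B], [p = rho ^ 2] and [q = sigma ^ 2]:
   [L^2 - 2 e Z L + q Z^2 + e^2 p - p q = 0]. *)
Lemma cos_sum_matrix (D : comNzRingType) (e q : I -> D) (j : I) (l : seq I) :
  exists M : 'M[D]_(dbl (size l)),
  forall (phi : {rmorphism D -> R}) (sg th : I -> R),
    (forall i, i \in j :: l -> phi (e i) = sg i * cos (th i) /\ phi (q i) = sg i ^+ 2) ->
    exists2 v : 'rV[R]_(dbl (size l)), v != 0 &
      v *m map_mx phi M =
        ((\prod_(i <- j :: l) sg i) * cos (\sum_(i <- j :: l) th i)) *: v.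
Proof.
elim: l j => [|i l IH] j.
  exists (e j)%:M => phi sg th H; exists (const_mx 1).
    by apply/eqP => /matrixP/(_ ord0 ord0); rewrite !mxE => /eqP; rewrite oner_eq0.
  by rewrite map_scalar_mx mul_mx_scalar !big_seq1 (H j _).1 ?inE.
have [C HC] := IH i.
pose p := \prod_(k <- i :: l) q k.
pose B : 'M[D]_(dbl (size l)) := - (q j *: (C *m C) + ((e j ^+ 2 - q j) * p)%:M).
exists (block_mx 0 B 1%:M ((e j *+ 2) *: C)) => phi sg th H.
have [v vN0 vC] := HC phi sg th (fun k kl => H k (mem_behead (s := j :: _) kl)).
have [ej qj] := H j (mem_head _ _).
set rho := \prod_(k <- i :: l) sg k in vC; set A := \sum_(k <- i :: l) th k in vC.
have phip : phi p = rho ^+ 2.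
  rewrite /p /rho rmorph_prod -prodrXl big_seq [RHS]big_seq; apply: eq_bigr => k kl.
  by rewrite (H k _).2 // (mem_behead (s := j :: _) kl).
rewrite !(big_cons _ _ j) -/rho -/A; set L := sg j * rho * cos (th j + A).
(* The first block column sends this vector to [L *: v]; for the second one the eigenvector equation
   is the quadratic equation of [L]. *)
exists (row_mx v (L *: v)).
  by apply: contra vN0 => /eqP; rewrite -row_mx0 => /eq_row_mx[->].
rewrite map_block_mx mul_row_block map_mx0 map_mx1 mulmx0 add0r mulmx1 scale_row_mx.
congr row_mx.
rewrite /B map_mxN map_mxD !map_mxZ map_mxM map_scalar_mx.
rewrite mulmxN mulmxDr -!scalemxAr mulmxA vC mul_mx_scalar.
rewrite -!scalemxAl vC !scalerA -scalerDl -scaleNr -scalerDl; congr (_ *: _).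
rewrite !(rmorphM, rmorphB, rmorphXn, rmorphMn) /= ej qj phip /L cosD.
have key : (sg j * rho) ^+ 2 * (sin (th j) ^+ 2 * sin A ^+ 2) =
    (sg j * rho) ^+ 2 * ((1 - cos (th j) ^+ 2) * (1 - cos A ^+ 2)) by rewrite !sin2cos2.
move: key; set c := cos (th j); set s := sin (th j); set c' := cos A; set s' := sin A.
move=> key; lra.
Qed.

(** The characteristic polynomial of the matrix above. It has coefficients in [D], hence serves all
    specialisations [phi] at once. *)
Lemma cos_sum_poly (D : comNzRingType) (e q : I -> D) (j : I) (l : seq I) :
  exists T : {poly D}, [/\ T \is monic, size T = (2 ^ size l).+1 &
  forall (phi : {rmorphism D -> R}) (sg th : I -> R),
    (forall i, i \in j :: l -> phi (e i) = sg i * cos (th i) /\ phi (q i) = sg i ^+ 2) ->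
    (map_poly phi T).[(\prod_(i <- j :: l) sg i) * cos (\sum_(i <- j :: l) th i)] = 0].
Proof.
have [M HM] := cos_sum_matrix e q j l; exists (char_poly M); split.
- exact: char_poly_monic.
- by rewrite size_char_poly dblE.
move=> phi sg th /HM[v vN0 vM]; apply/eqP; rewrite -rootE map_char_poly.
by rewrite -eigenvalue_root_char; apply/eigenvalueP; exists v.
Qed.

Fixpoint signed_sums (s : seq R) : seq R :=
  if s is t :: s' then
    [seq t + z | z <- signed_sums s'] ++ [seq - t + z | z <- signed_sums s']
  else [:: 0].

(** Each term exceeds the sum of all later ones, so the first sign in which two signed sums differ
    decides which is larger. *)
Fixpoint superincreasing (s : seq R) : bool :=
  if s is t :: s' then (\sum_(z <- s') z < t) && superincreasing s' else true.

Lemma size_signed_sums s : size (signed_sums s) = (2 ^ size s)%N.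
Proof. by elim: s => //= t s IH; rewrite size_cat !size_map IH expnS mul2n addnn. Qed.

Lemma superincreasing_ge0 s : superincreasing s -> 0 <= \sum_(t <- s) t.
Proof.
elim: s => [|t s IH] /=; first by rewrite big_nil.
by case/andP=> st ss; rewrite big_cons addr_ge0 ?IH // (le_trans (IH ss) (ltW st)).
Qed.

Lemma signed_sums_bound s z : superincreasing s -> z \in signed_sums s ->
  `|z| <= \sum_(t <- s) t.
Proof.
elim: s z => [z _|t s IH z /= /andP[st ss]]; rewrite ?inE.
  by rewrite big_nil => /eqP ->; rewrite normr0.
have s0 := superincreasing_ge0 ss; rewrite big_cons.
by rewrite mem_cat => /orP[] /mapP[z' /(IH _ ss)]; rewrite ler_norml => /andP[z1 z2] ->;
  rewrite ler_norml; apply/andP; split; lra.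
Qed.

Lemma signed_sums_uniq s : superincreasing s -> uniq (signed_sums s).
Proof.
elim: s => //= t s IH /andP[st ss].
rewrite cat_uniq !map_inj_uniq ?IH //=; try exact: addrI.
rewrite andbT; apply/hasPn => _ /mapP[z zs ->]; apply/mapP => -[z' z's E].
have := signed_sums_bound ss zs; have := signed_sums_bound ss z's.
rewrite !ler_norml => /andP[? ?] /andP[? ?]; lra.
Qed.

Definition sign_flip (th th' : I -> R) := forall i, th' i = th i \/ th' i = - th i.

Lemma signed_sums_flip (l : seq I) (th : I -> R) z : uniq l ->
  z \in signed_sums (map th l) -> exists th', [/\ sign_flip th th',
    forall i, i \notin l -> th' i = th i & z = \sum_(i <- l) th' i].
Proof.
elim: l z => [z _|j l IH z /= /andP[jl ul]].
  by rewrite inE => /eqP ->; exists th; split=> //; [left|rewrite big_nil].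
rewrite mem_cat => /orP[] /mapP[z' /(IH _ ul)[th' [fl out ->]] ->].
  exists th'; split=> // [i|]; last by rewrite big_cons out.
  by rewrite inE negb_or => /andP[_]; exact: out.
exists (fun i => if i == j then - th i else th' i); split=> [i|i|].
- by case: eqP => _; [right|apply: fl].
- by rewrite inE negb_or => /andP[/negbTE -> /out].
- rewrite big_cons eqxx; congr (_ + _).
  by apply: eq_big_seq => i il; case: eqP jl => // <-; rewrite il.
Qed.

(** The sign of [th j] is kept positive because cosine is even. All signed sums then lie strictly
    between 0 and [pi], where cosine is injective and less than 1. *)
Lemma cos_sum_roots (j : I) (l : seq I) (th : I -> R) (c : R) :
  0 < c -> uniq (j :: l) -> superincreasing (map th (j :: l)) ->
  \sum_(i <- j :: l) th i < pi ->
  exists rs : seq R, [/\ uniq rs, size rs = (2 ^ size l)%N &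
    forall w, w \in rs -> w < c /\
      exists2 th', sign_flip th th' & w = c * cos (\sum_(i <- j :: l) th' i)].
Proof.
move=> c0 /= /andP[jl ul] /andP[]; rewrite big_map big_cons => lj sl ltpi.
have bound z : z \in signed_sums (map th l) -> 0 < th j + z < pi.
  move=> /(signed_sums_bound sl); rewrite big_map ler_norml => /andP[? ?].
  by apply/andP; split; lra.
exists [seq c * cos (th j + z) | z <- signed_sums (map th l)]; split.
- rewrite map_inj_in_uniq ?signed_sums_uniq // => z z' /bound/andP[? ?] /bound/andP[? ?].
  by move=> /(mulfI (lt0r_neq0 c0)) /cos_inj E; apply: (addrI (th j)); apply: E;
    rewrite in_itv /= !ltW.
- by rewrite size_map size_signed_sums size_map.
move=> _ /mapP[z zs ->]; have /andP[z0 zpi] := bound z zs; split.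
  rewrite gtr_pMr // -(cos0 R) ltr_cos ?in_itv /= ?lexx ?pi_ge0 ?(ltW z0) ?(ltW zpi) //.
have [th' [fl out ->]] := signed_sums_flip ul zs.
by exists th' => //; rewrite big_cons out.
Qed.

End CosineOfSums.

Section CosineDivision.
Variables (R : realType) (I : eqType) (n : nat).

(* Flipping signs of angles preserves the cosines, hence turns one root of [T]
   into all its roots. *)
Lemma cos_sum_dvd (e q : I -> mvpoly n R) (j : I) (l : seq I) (T P : {poly mvpoly n R})
    (Y : 'rV[R]_n -> Prop) (sg th : 'rV[R]_n -> I -> R) :
  T \is monic -> size T = (2 ^ size l).+1 ->
  (forall (phi : {rmorphism mvpoly n R -> R}) (sg th : I -> R),
    (forall i, i \in j :: l -> phi (e i) = sg i * cos (th i) /\ phi (q i) = sg i ^+ 2) ->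
    (map_poly phi T).[(\prod_(i <- j :: l) sg i) * cos (\sum_(i <- j :: l) th i)] = 0) ->
  uniq (j :: l) ->
  (forall q, (forall y, Y y -> pe y q = 0) -> q = 0) ->
  (forall y, Y y -> [/\
     forall i, i \in j :: l ->
       [/\ 0 < sg y i, pe y (e i) = sg y i * cos (th y i) & pe y (q i) = sg y i ^+ 2],
     superincreasing (map (th y) (j :: l)), \sum_(i <- j :: l) th y i < pi &
     forall th', sign_flip (th y) th' ->
       (map_poly (pe y) P).[(\prod_(i <- j :: l) sg y i) * cos (\sum_(i <- j :: l) th' i)] = 0]) ->
  exists K, P = K * T.
Proof.
move=> Tmon Tsize Troot ul Ydense YP.
have /choice[rs rsP] : forall y, exists rs : seq R, Y y -> [/\ uniq rs, size rs = (2 ^ size l)%N &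
    forall z, z \in rs -> (map_poly (pe y) T).[z] = 0 /\ (map_poly (pe y) P).[z] = 0].
  move=> y; have [/YP[eq_y sup ltpi P0]|nY] := pselect (Y y); last by exists [::].
  have c0 : 0 < \prod_(i <- j :: l) sg y i.
    by rewrite big_seq; apply: prodr_gt0 => i /eq_y[].
  have [rs [rs_uniq rs_size rsP]] := cos_sum_roots c0 ul sup ltpi.
  exists rs => _; split=> // z /rsP[_ [th' fl ->]]; split; last exact: P0.
  apply: Troot => i /eq_y[_ -> ->]; split=> //.
  by case: (fl i) => ->; rewrite ?cosN.
apply: (monic_dvd Tmon Ydense (rs := rs)) => y /rsP[? sz ?]; split=> //.
by rewrite Tsize sz.
Qed.

End CosineDivision.

(** * Positive semidefinite completions of a cycle *)

Section QuadraticForms.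
Variables (R : realType) (m : nat).
Implicit Types (X : 'M[R]_m) (u v w : 'rV[R]_m).

Definition bform X v w : R := (v *m X *m w^T) ord0 ord0.

Definition psdmx X : Prop := X^T = X /\ forall v, 0 <= bform X v v.

Local Notation e j := (delta_mx ord0 j : 'rV[R]_m).

Lemma bformDl X u v w : bform X (u + v) w = bform X u w + bform X v w.
Proof. by rewrite /bform !mulmxDl mxE. Qed.

Lemma bformZl X a v w : bform X (a *: v) w = a * bform X v w.
Proof. by rewrite /bform -!scalemxAl mxE. Qed.

Lemma bformC X v w : X^T = X -> bform X v w = bform X w v.
Proof.
move=> Xs; have -> : bform X v w = ((v *m X *m w^T)^T) ord0 ord0 by rewrite mxE.
by rewrite !trmx_mul trmxK Xs mulmxA.
Qed.

Lemma bformDr X u v w : bform X u (v + w) = bform X u v + bform X u w.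
Proof. by rewrite /bform linearD mulmxDr mxE. Qed.

Lemma bformZr X a v w : bform X v (a *: w) = a * bform X v w.
Proof. by rewrite /bform linearZ -scalemxAr mxE. Qed.

Lemma bform_delta X j k : bform X (e j) (e k) = X j k.
Proof.
by rewrite /bform -rowE trmx_delta -colE !mxE.
Qed.

Definition bformE := (bformDl, bformDr, bformZl, bformZr, bform_delta).

Lemma psd_null X v w : psdmx X -> bform X v v = 0 -> bform X v w = 0.
Proof.
move=> [Xs X0] v0; have := X0 w; set c := bform X w w => c0.
have H t : 0 <= 2 * t * bform X v w + t ^+ 2 * c + 0.
  have := X0 (v + t *: w); rewrite !bformE v0 (bformC w v Xs) -/c; lra.
set b := bform X v w in H *.
(* At this [t] the form is negative unless [b = 0]; dividing by [c + 1] instead of [c] covers the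
   case [c = 0]. *)
have := H (- b / (c + 1)); have c1 : 0 < c + 1 by lra.
have -> : 2 * (- b / (c + 1)) * b + (- b / (c + 1)) ^+ 2 * c + 0 =
    - (b / (c + 1)) ^+ 2 * (c + 2).
  by field; rewrite gt_eqF.
move=> h; have : (b / (c + 1)) ^+ 2 <= 0 by nra.
rewrite le_eqVlt ltNge sqr_ge0 orbF sqrf_eq0 mulf_eq0 invr_eq0.
by rewrite (gt_eqF c1) orbF => /eqP.
Qed.

Definition minor2 X j k := X j j * X k k - X j k ^+ 2.

Lemma minor2_pos_diag X j k : psdmx X -> 0 < minor2 X j k -> 0 < X j j.
Proof.
move=> [_ X0]; rewrite /minor2 => D.
by have := X0 (e j); rewrite bform_delta le_eqVlt => /predU1P[E|//]; move: D; rewrite -E; nra.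
Qed.

Lemma minor2_null X j k (x y : R) : psdmx X -> 0 < minor2 X j k ->
  bform X (x *: e j + y *: e k) (x *: e j + y *: e k) = 0 -> x = 0 /\ y = 0.
Proof.
move=> Xp D; have a0 := minor2_pos_diag Xp D; move: D; rewrite /minor2.
have Xs : X k j = X j k by rewrite -[in LHS]Xp.1 mxE.
rewrite !bformE Xs; set a := X j j in a0 *; set c := X k k; set b := X j k => D E.
have E2 : (a * x + b * y) ^+ 2 + (a * c - b ^+ 2) * y ^+ 2 = 0.
  by transitivity (a * (x * (x * a) + x * (y * b) + (y * (x * b) + y * (y * c))));
    [ring | rewrite -[RHS](mulr0 a); congr (_ * _); rewrite -E; ring].
have y0 : y = 0.
  apply/eqP; rewrite -sqrf_eq0 eq_le sqr_ge0 andbT.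
  have := sqr_ge0 (a * x + b * y); nra.
split=> //; move: E2; rewrite y0 !mulr0 expr0n /= mulr0 !addr0 => /eqP.
by rewrite sqrf_eq0 mulf_eq0 (gt_eqF a0) => /eqP.
Qed.

Lemma psd_minor2_ge0 X j k : psdmx X -> 0 <= minor2 X j k.
Proof.
move=> Xp; have Xs : X k j = X j k by rewrite -[in LHS]Xp.1 mxE.
have := Xp.2 (1 *: e j); rewrite !bformE !mul1r le_eqVlt => /predU1P[E|a0].
  have := psd_null (e k) Xp (etrans (bform_delta X j j) (esym E)).
  by rewrite bform_delta /minor2 -E => ->; rewrite mul0r expr0n subrr.
have := Xp.2 (- X j k *: e j + X j j *: e k).
rewrite !bformE Xs /minor2; set a := X j j in a0 *; set b := X j k; set c := X k k => H.
rewrite -(pmulr_rge0 _ a0); apply: le_trans H _.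
by rewrite le_eqVlt; apply/orP; left; apply/eqP; ring.
Qed.

(* Replace the vector [v_j] of a Gram configuration by its projection on
   [span (v_a, v_b)] plus a vector of the right length in a new dimension. *)
Lemma psd_push X (j a b : 'I_m) : psdmx X -> a != j -> b != j -> a != b ->
  0 < minor2 X a b ->
  (forall x y z, bform X (x *: e a + y *: e b + z *: e j) (x *: e a + y *: e b + z *: e j) = 0 ->
     z = 0) ->
  exists X', [/\ psdmx X', X' j j = X j j /\ (X' j a = X j a /\ X' j b = X j b),
    forall k l, k != j -> l != j -> X' k l = X k l &
    forall v, bform X' v v = 0 -> v ord0 j = 0 /\ bform X v v = 0].
Proof.
move=> Xp aj bj ab D nondeg; have [Xs X0] := Xp.
have sym k l : X k l = X l k by rewrite -[in LHS]Xs mxE.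
(* [al] and [be] are the coordinates of the projection of [v_j] on [span (v_a, v_b)], by Cramer's
   rule. *)
pose al := (X j a * X b b - X j b * X a b) / minor2 X a b.
pose be := (X j b * X a a - X j a * X a b) / minor2 X a b.
have D0 : minor2 X a b != 0 by rewrite gt_eqF.
have Ea : al * X a a + be * X b a = X j a.
  by rewrite /al /be (sym b a); move: D0; rewrite /minor2 => D0; field.
have Eb : al * X a b + be * X b b = X j b.
  by rewrite /al /be; move: D0; rewrite /minor2 => D0; field.
(* [u] represents the projection minus [v_j]. Its squared length [d] is what the component in the
   new dimension must supply, and [A] replaces [e_j] by the projection. *)
pose u : 'rV[R]_m := al *: e a + be *: e b + (-1) *: e j.
have d0 : 0 < bform X u u.
  rewrite lt_neqAle X0 andbT eq_sym; apply/eqP => /nondeg /eqP.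
  by rewrite oppr_eq0 oner_eq0.
set d := bform X u u in d0.
pose A : 'M[R]_m := 1%:M + (e j)^T *m u.
pose X' := A *m X *m A^T + d *: delta_mx j j.
have vA v : v *m A = v + v ord0 j *: u.
  rewrite mulmxDr mulmx1 mulmxA trmx_delta -colE; congr (_ + _).
  by rewrite [col j v]mx11_scalar mul_scalar_mx mxE.
have X'E v w : bform X' v w = bform X (v *m A) (w *m A) + d * (v ord0 j * w ord0 j).
  rewrite /bform /X' mulmxDr mulmxDl mxE; congr (_ + _).
    by rewrite trmx_mul !mulmxA.
  rewrite -scalemxAr -scalemxAl mxE; congr (_ * _).
  rewrite -(mul_delta_mx (ord0 : 'I_1)) mulmxA -colE -mulmxA -trmx_delta -trmx_mul -colE.
  by rewrite !mxE big_ord1 !mxE.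
have eA k : k != j -> e k *m A = e k.
  by move=> kj; rewrite vA mxE eqxx eq_sym (negbTE kj) scale0r addr0.
have ejA : e j *m A = al *: e a + be *: e b.
  by rewrite vA mxE !eqxx /= scale1r /u scaleN1r addrC subrK.
exists X'; split.
- split; first by rewrite /X' linearD linearZ /= trmx_delta !trmx_mul trmxK Xs mulmxA.
  by move=> v; rewrite X'E addr_ge0 // mulr_ge0 ?(ltW d0) // -expr2 sqr_ge0.
- have X'j l : l != j -> X' j l = al * X a l + be * X b l.
    move=> lj; rewrite -(bform_delta X') X'E ejA eA // !bformE !mxE.
    by rewrite eqxx (eq_sym j) (negbTE lj) !mulr0 addr0.
  split; last by rewrite (X'j a aj) (X'j b bj).
  rewrite -(bform_delta X') X'E ejA /d /u !bformE !mxE !eqxx !mulr1.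
  move: Ea Eb; rewrite (sym a j) (sym b j) (sym b a).
  set xa := X j a; set xb := X j b => Ea Eb.
  have -> : xa = al * X a a + be * X a b by rewrite Ea.
  have -> : xb = al * X a b + be * X b b by rewrite Eb.
  ring.
- move=> k l kj lj; rewrite -(bform_delta X') X'E !eA // bform_delta !mxE.
  by rewrite (eq_sym j) (negbTE kj) andbF mul0r mulr0 addr0.
- move=> v; rewrite X'E => /eqP; rewrite paddr_eq0 //; last first.
    by rewrite mulr_ge0 ?(ltW d0) // -expr2 sqr_ge0.
  rewrite mulf_eq0 (gt_eqF d0) -expr2 sqrf_eq0 => /andP[/eqP v0 /eqP vj]; split=> //.
  by move: v0; rewrite vA vj scale0r addr0.
Qed.

End QuadraticForms.

Section CycleIndices.
Variable m : nat.
Implicit Types (i j : 'I_m).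

Lemma val_iter_ordS k i : nat_of_ord (iter k (@ordS m) i) = ((i + k) %% m)%N.
Proof.
elim: k => [|k IH]; first by rewrite addn0 modn_small.
by rewrite iterS /= IH addnS -addn1 modnDml addn1.
Qed.

Lemma ordS_iter_onto i j : exists2 k, (k < m)%N & iter k (@ordS m) i = j.
Proof.
exists ((j + (m - i)) %% m)%N; first by rewrite ltn_mod (leq_ltn_trans _ (ltn_ord i)).
apply: val_inj; rewrite /= val_iter_ordS modnDmr addnCA subnKC ?(ltnW (ltn_ord i)) //.
by rewrite modnDr modn_small.
Qed.

Lemma iter_ordS_neq k i : (0 < k < m)%N -> iter k (@ordS m) i != i.
Proof.
case/andP=> k0 km; rewrite -val_eqE /= val_iter_ordS.
apply/eqP; have := ltn_ord i => im.
have [lt|ge] := ltnP (i + k) m; first by rewrite modn_small //; lia.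
by rewrite -(subnK ge) modnDr modn_small; lia.
Qed.

Lemma ordS_neq i : (1 < m)%N -> ordS i != i.
Proof. by move=> m1; apply: (@iter_ordS_neq 1). Qed.

Lemma ordS2_neq i : (2 < m)%N -> ordS (ordS i) != i.
Proof. by move=> m2; apply: (@iter_ordS_neq 2). Qed.

Lemma ordS3_neq i : (3 < m)%N -> ordS (ordS (ordS i)) != i.
Proof. by move=> m2; apply: (@iter_ordS_neq 3). Qed.

End CycleIndices.

(** * From a nonplanar semidefinite completion to a definite one *)

Section CycleCompletion.
Variables (R : realType) (m : nat).
Hypothesis m2 : (2 < m)%N.
Implicit Types (X : 'M[R]_m).
Local Notation e j := (delta_mx ord0 j : 'rV[R]_m).

Lemma minor2_gt0 X j k : psdmx X ->
  (forall x y, bform X (x *: e j + y *: e k) (x *: e j + y *: e k) = 0 -> x = 0 /\ y = 0) ->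
  0 < minor2 X j k.
Proof.
move=> Xp nd; have Xs : X k j = X j k by rewrite -[in LHS]Xp.1 mxE.
have pos x y : x != 0 \/ y != 0 -> 0 < bform X (x *: e j + y *: e k) (x *: e j + y *: e k).
  move=> xy; rewrite lt_neqAle Xp.2 andbT eq_sym; apply/eqP => /nd[x0 y0].
  by move: xy; rewrite x0 y0 eqxx; case.
have a0 : 0 < X j j.
  have := pos 1 0 (or_introl (oner_neq0 _)).
  by rewrite scale0r addr0 scale1r bform_delta.
have := pos (- X j k) (X j j) (or_intror (lt0r_neq0 a0)).
rewrite !bformE Xs /minor2; set a := X j j in a0 *; set b := X j k; set c := X k k.
by rewrite -(pmulr_rgt0 (a * c - b ^+ 2) a0); congr (0 < _); ring.
Qed.

(** The three consecutive Gram vectors starting at [j] are dependent; the middle one comes last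
    because it is the one to be moved by [psd_push]. *)
Definition degenerate X j := exists x y z, (x != 0 \/ y != 0 \/ z != 0) /\
  let v := x *: e j + y *: e (ordS (ordS j)) + z *: e (ordS j) in bform X v v = 0.

Lemma cycle_posdef_completion X : psdmx X ->
  (forall i, 0 < minor2 X i (ordS i)) -> (exists j, ~ degenerate X j) ->
  exists X', posdefmx X' /\ forall i, X' i i = X i i /\ X' i (ordS i) = X i (ordS i).
Proof.
move=> Xp D [j0 nd].
pose jj k := iter k (@ordS m) (ordS j0).
have step X' j : psdmx X' -> (forall i, X' i i = X i i /\ X' i (ordS i) = X i (ordS i)) ->
   ~ degenerate X' j -> exists X'', [/\ psdmx X'',
     (forall i, X'' i i = X i i /\ X'' i (ordS i) = X i (ordS i)) &
     forall v, bform X'' v v = 0 -> v ord0 (ordS j) = 0 /\ bform X' v v = 0].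
  move=> X'p eqX ndj; set k := ordS (ordS j).
  have s1 : j != ordS j by rewrite eq_sym ordS_neq // ltnW.
  have s2 : k != ordS j by rewrite ordS_neq // ltnW.
  have s3 : j != k by rewrite eq_sym ordS2_neq.
  have nd3 x y z :
      bform X' (x *: e j + y *: e k + z *: e (ordS j))
               (x *: e j + y *: e k + z *: e (ordS j)) = 0 ->
      [/\ x = 0, y = 0 & z = 0].
    move=> E; apply: contrapT => N; apply: ndj; exists x, y, z; split=> //.
    have [x0|] := eqVneq x 0; last by left.
    have [y0|] := eqVneq y 0; last by right; left.
    by right; right; apply/eqP => z0; apply: N.
  have Djk : 0 < minor2 X' j k.
    apply: minor2_gt0 => // x y E; have := nd3 x y 0; rewrite scale0r addr0.
    by case/(_ E).
  have [] := psd_push X'p s1 s2 s3 Djk; first by move=> x y z /nd3[].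
  move=> X'' [X''p [Ejj [Eja Ejb]] Ekl null]; exists X''; split=> // i.
  have symm (Y : 'M[R]_m) (Yp : psdmx Y) p q : Y p q = Y q p by rewrite -[in LHS]Yp.1 mxE.
  have [->|ij] := eqVneq i (ordS j).
    by rewrite Ejj Ejb; apply: eqX.
  rewrite Ekl //; split; first exact: (eqX i).1.
  have [E|Sij] := eqVneq (ordS i) (ordS j); last by rewrite Ekl //; exact: (eqX i).2.
  have -> : i = j by exact: can_inj (@ordSK m) _ _ E.
  by rewrite (symm _ X''p) Eja (symm _ X'p); exact: (eqX j).2.
(* After [k + 1] moves, null vectors vanish at the [k + 1] vertices already moved. Going round the
   whole cycle leaves only the zero vector. *)
have main k : exists X', [/\ psdmx X',
     (forall i, X' i i = X i i /\ X' i (ordS i) = X i (ordS i)) &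
     forall v, bform X' v v = 0 -> forall l, (l <= k)%N -> v ord0 (jj l) = 0].
  elim: k => [|k [X' [X'p eqX null]]].
    have [X' [? ? null]] := step X j0 Xp (fun i => conj erefl erefl) nd.
    by exists X'; split=> // v /null[v0 _] l; rewrite leqn0 => /eqP ->.
  (* The next triple is independent: a relation has coefficient 0 at the vertex just moved, and the
     positive minor of the other two vertices kills the rest. *)
  have [|X'' [? ? null']] := step X' (jj k) X'p eqX.
    move=> [x [y [z [N /= E]]]].
    have /(_ k (leqnn k)) := null _ E; rewrite !mxE !eqxx /=.
    rewrite eq_sym (negbTE (ordS2_neq _ m2)) eq_sym (negbTE (ordS_neq _ (ltnW m2))) /=.
    rewrite mulr1 !mulr0 !addr0 => x0; move: E; rewrite x0 scale0r add0r addrC => E.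
    have DX' : 0 < minor2 X' (ordS (jj k)) (ordS (ordS (jj k))).
      by have := D (ordS (jj k)); rewrite /minor2 !(eqX _).1 (eqX _).2.
    have [z0 y0] := minor2_null X'p DX' E.
    by move: N; rewrite x0 y0 z0 eqxx /=; case=> [|[]].
  exists X''; split=> // v /null'[vk vX'] l; rewrite leq_eqVlt => /predU1P[->//|].
  by rewrite ltnS; exact: null.
have [X' [X'p eqX null]] := main m; exists X'; split=> //; split; first exact: X'p.1.
move=> v vN0; rewrite lt_neqAle [X in _ && X]X'p.2 andbT eq_sym.
apply/eqP => v0; move/eqP: vN0; apply; apply/rowP => i; rewrite mxE.
have [k km <-] := ordS_iter_onto (ordS j0) i.
exact: (null v v0 k (ltnW km)).
Qed.

End CycleCompletion.

(** * Angles of planar completions *)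

Section PlanarCycles.
Variables (R : realType) (m : nat).
Hypothesis m2 : (2 < m)%N.
Implicit Types (X : 'M[R]_m).
Local Notation e j := (delta_mx ord0 j : 'rV[R]_m).

Lemma unit_circle_angle (u v : R) : u ^+ 2 + v ^+ 2 = 1 -> exists t, u = cos t /\ v = sin t.
Proof.
move=> uv; have u1 : -1 <= u <= 1.
  by rewrite -ler_norml -(@ler_sqr _ _ 1) ?nnegrE // expr1n -normrX ger0_norm ?sqr_ge0 //;
    have := sqr_ge0 v; lra.
have sE : sin (acos u) = `|v|.
  by rewrite sin_acos // -uv addrAC subrr add0r sqrtr_sqr.
have [v0|v0] := leP 0 v.
  by exists (acos u); rewrite acosK ?in_itv // sE ger0_norm.
exists (- acos u); rewrite cosN sinN acosK ?in_itv // sE ltr0_norm //.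
by rewrite opprK.
Qed.

(* Every vector of the Gram configuration lies in the plane of the first two,
   so the configuration is given by polar angles [al i]. *)
Lemma planar_cycle_angles X : psdmx X -> (forall i, 0 < minor2 X i (ordS i)) ->
  (forall j, degenerate X j) ->
  exists be : 'I_m -> R, \sum_i be i = 0 /\
    forall i, X i (ordS i) = Num.sqrt (X i i * X (ordS i) (ordS i)) * cos (be i).
Proof.
move=> Xp D deg.
have sym k l : X k l = X l k by rewrite -[in LHS]Xp.1 mxE.
(* In the null relation, the coefficient of [v_(j+2)] is nonzero because the minor of the edge from
   [j] is positive. *)
have dep j : exists p q, forall l, X (ordS (ordS j)) l = p * X j l + q * X (ordS j) l.
  have [x [y [z [N /= E]]]] := deg j.
  have y0 : y != 0.
    apply/eqP => y0; move: E; rewrite y0 scale0r addr0 => /(minor2_null Xp (D j))[x0 z0].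
    by move: N; rewrite x0 y0 z0 eqxx /=; case=> [|[]].
  exists (- x / y), (- z / y) => l.
  have := psd_null (e l) Xp E; rewrite !bformE => El.
  apply: (mulfI y0); move: El; set a := X _ l; set b := X _ l; set c := X _ l => El.
  have -> : y * (- x / y * a + - z / y * c) = - (x * a) - z * c by field.
  lra.
have m0 : (0 < m)%N by lia.
pose o := Ordinal m0; set o' := ordS o.
have span k : exists p q, forall l, X (iter k (@ordS m) o) l = p * X o l + q * X o' l.
  suff [] : (exists p q, forall l, X (iter k (@ordS m) o) l = p * X o l + q * X o' l) /\
         (exists p q, forall l, X (iter k.+1 (@ordS m) o) l = p * X o l + q * X o' l) by [].
  elim: k => [|k [[p [q E]] [p' [q' E']]]].
    by split; [exists 1, 0 | exists 0, 1] => l; rewrite /= ?mul1r ?mul0r ?addr0 ?add0r.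
  split; first by exists p', q'.
  have [r [s Er]] := dep (iter k (@ordS m) o).
  exists (r * p + s * p'), (r * q + s * q') => l.
  by rewrite iterS iterS Er E -iterS E'; ring.
have {}span k : exists pq : R * R, forall l, X k l = pq.1 * X o l + pq.2 * X o' l.
  have [n _ <-] := ordS_iter_onto o k; have [p [q E]] := span n.
  by exists (p, q).
have [pq pqE] := choice span.
have Doo := D o; rewrite -/o' in Doo; have Xo := minor2_pos_diag Xp Doo.
(* Coordinates of the plane in which the first vector is [(a, 0)] and the second is [(b, c)]. *)
pose a := Num.sqrt (X o o); have a0 : 0 < a by rewrite sqrtr_gt0.
have aa : a ^+ 2 = X o o by rewrite sqr_sqrtr // ltW.
pose b := X o o' / a; pose c := Num.sqrt (minor2 X o o') / a.
have ab : a * b = X o o' by rewrite /b mulrC divfK // gt_eqF.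
have bc : b ^+ 2 + c ^+ 2 = X o' o'.
  rewrite /b /c !expr_div_n (sqr_sqrtr (ltW Doo)) aa /minor2 -mulrDl addrC subrK.
  by rewrite mulrAC divff ?mul1r // gt_eqF.
pose U k := (pq k).1 * a + (pq k).2 * b; pose V k := (pq k).2 * c.
have gram k l : X k l = U k * U l + V k * V l.
  rewrite pqE (sym o l) (sym o' l) !(pqE l) (sym o' o) -aa -ab -bc /U /V; ring.
have Xk k : 0 < X k k := minor2_pos_diag Xp (D k).
pose r k := Num.sqrt (X k k); have r0 k : 0 < r k by rewrite sqrtr_gt0.
have rr k : r k ^+ 2 = X k k by rewrite sqr_sqrtr // ltW.
have polar k : exists t, U k / r k = cos t /\ V k / r k = sin t.
  apply: unit_circle_angle; rewrite !expr_div_n rr -mulrDl gram -!expr2 divff //.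
  by have := Xk k; rewrite gram -!expr2 => /gt_eqF ->.
have [al alE] := choice polar.
have UE k : U k = r k * cos (al k) by rewrite -(alE k).1 mulrC divfK // gt_eqF.
have VE k : V k = r k * sin (al k) by rewrite -(alE k).2 mulrC divfK // gt_eqF.
(* Differences of polar angles telescope around the cycle, so their sum is exactly 0 and not merely
   a multiple of [2 * pi]. *)
exists (fun i => al (ordS i) - al i); split.
  by rewrite sumrB [X in _ - X](reindex_inj (@ordS_inj m)) /= subrr.
move=> i; rewrite gram !UE !VE sqrtrM ?(ltW (Xk _)) // cosB /r; ring.
Qed.

End PlanarCycles.

(** * The boundary of the cone *)

Local Open Scope classical_set_scope.
Local Open Scope ring_scope.

Section Closure.
Variables (R : realType) (m : nat).
Implicit Types (s : 'rV[R]_(m + m)) (X : 'M[R]_m).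
Local Notation e j := (delta_mx ord0 j : 'rV[R]_m).

Definition completes X s :=
  forall i, X i i = s ord0 (dg i) /\ X i (ordS i) = s ord0 (eg i).

Lemma bounded_cluster n (u : nat -> 'rV[R]_n) (C : R) : (forall k i, `|u k ord0 i| <= C) ->
  exists p : 'rV[R]_n, forall N eps, 0 < eps ->
    exists2 k, (N <= k)%N & forall i, `|p ord0 i - u k ord0 i| < eps.
Proof.
move=> uC; pose K : set 'rV[R]_n := [set v : 'rV[R]_n | forall i, `[- C, C]%classic (v ord0 i)].
have Kc : compact K.
  by apply: (@rV_compact R n (fun=> `[- C, C]%classic)) => i; exact: segment_compact.
have [|p [_ up]] := Kc (u @ \oo).
  by exists 0%N => // k _ i /=; rewrite in_itv /= -ler_norml.
exists p => N eps eps0.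
have [||_ [[k Nk <-] puk]] := up (u @` [set k | (N <= k)%N]) (ball p eps).
- by exists N => // k Nk; exists k.
- exact: nbhsx_ballx.
by exists k => // i; apply: (puk.2 ord0 i).
Qed.

Lemma psd_entry_bound X (C : R) : psdmx X -> (forall i, X i i <= C) -> forall i j, `|X i j| <= C.
Proof.
move=> [Xs X0] XC i j.
have sym : X j i = X i j by rewrite -[in LHS]Xs mxE.
have := X0 (1 *: e i + 1 *: e j); have := X0 (1 *: e i + (-1) *: e j).
rewrite !bformE sym ler_norml; have := XC i; have := XC j.
set a := X i i; set b := X j j; set c := X i j => *; apply/andP; split; lra.
Qed.

Lemma bformE_sum X (v w : 'rV[R]_m) :
  bform X v w = \sum_i \sum_j v ord0 i * X i j * w ord0 j.
Proof.
rewrite /bform mxE exchange_big; apply: eq_bigr => j _.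
by rewrite !mxE mulr_suml.
Qed.

Lemma bform_perturb X X' (eps : R) (v : 'rV[R]_m) : (forall i j, `|X i j - X' i j| <= eps) ->
  bform X' v v - eps * \sum_i \sum_j `|v ord0 i * v ord0 j| <= bform X v v.
Proof.
move=> XX'; rewrite !bformE_sum lerBlDr -lerBlDl -sumrB mulr_sumr; apply: ler_sum => i _.
rewrite -sumrB mulr_sumr; apply: ler_sum => j _.
rewrite -[_ - _](_ : - (v ord0 i * v ord0 j) * (X i j - X' i j) = _); last by ring.
apply: le_trans (ler_norm _) _; rewrite normrM normrN mulrC ler_wpM2r //.
Qed.

(** Completions of nearby points of the cone have entries bounded by their diagonals, so by
    compactness they cluster at a matrix, which is semidefinite and completes [s]. *)
Lemma closure_cycle_cone s : closure (@cycle_cone R m) s ->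
  exists2 X, psdmx X & completes X s.
Proof.
move=> cl.
have near k : exists sX : 'rV[R]_(m + m) * 'M[R]_m,
   [/\ forall i, `|s ord0 i - sX.1 ord0 i| < k.+1%:R^-1, psdmx sX.2 & completes sX.2 sX.1].
  have [|s' [[X [[Xs X0] XE]] s's]] := cl (ball s k.+1%:R^-1).
    by apply: nbhsx_ballx; rewrite invr_gt0 ltr0n.
  exists (s', X); split=> //= [i|]; first exact: (s's.2 ord0 i).
  split=> // v; have [->|/X0/ltW//] := eqVneq v 0.
  by rewrite /bform !mul0mx mxE.
have [sX sXP] := choice near.
pose C := \sum_i `|s ord0 i| + 1.
have bound k i j : `|(sX k).2 i j| <= C.
  have [sk Xk XsE] := sXP k; apply: psd_entry_bound => // l.
  have k1 : (k.+1%:R : R)^-1 <= 1 by rewrite invf_le1 ?ltr0n // ler1n.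
  have := sk (dg l); rewrite (XsE l).1 ltr_norml => /andP[lk _].
  move: k1 lk; move: (_^-1) => t k1 lk.
  have : `|s ord0 (dg l)| <= \sum_i `|s ord0 i|.
    by rewrite (bigD1 (dg l)) //= lerDl sumr_ge0.
  have := ler_norm (s ord0 (dg l)); rewrite /C.
lra.
have [|p pP] := @bounded_cluster _ (fun k => mxvec (sX k).2) C.
  by move=> k i; case/mxvec_indexP: i => i j; rewrite mxvecE.
pose X := vec_mx p : 'M[R]_m.
have approx eps : 0 < eps -> exists k, [/\ forall i, `|s ord0 i - (sX k).1 ord0 i| < eps,
     forall i j, `|X i j - (sX k).2 i j| < eps, psdmx (sX k).2 & completes (sX k).2 (sX k).1].
  move=> eps0.
  have [N Neps] : exists N : nat, N.+1%:R^-1 < eps.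
    have [N _ NP] := near_infty_natSinv_lt (PosNum eps0).
    by exists N; apply: (NP N) => /=.
  have [k Nk kP] := pP N eps eps0; have [sk Xk XsE] := sXP k; exists k; split=> //.
    move=> i; apply: lt_trans (sk i) (le_lt_trans _ Neps).
    by rewrite lef_pV2 ?posrE ?ltr0n // ler_nat.
  by move=> i j; have := kP (mxvec_index i j); rewrite mxvecE -[p]vec_mxK mxvecE.
have small (x : R) : (forall eps, 0 < eps -> `|x| <= 2 * eps) -> x = 0.
  move=> xeps; apply/eqP; rewrite -normr_le0 leNgt; apply/negP => x0.
  have /xeps : 0 < `|x| / 4 by rewrite divr_gt0.
  lra.
exists X.
  split.
    apply/matrixP => i j; rewrite mxE; apply/eqP; rewrite -subr_eq0; apply/eqP.
    apply: small => eps /approx[k [_ Xk [Xs _] _]].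
    have : (sX k).2 j i = (sX k).2 i j by rewrite -[in LHS]Xs mxE.
    have := Xk i j; have := Xk j i; rewrite !ltr_norml ler_norml => /andP[? ?] /andP[? ?] E.
    by apply/andP; split; lra.
  move=> v; rewrite leNgt; apply/negP => v0.
  set S := \sum_i \sum_j `|v ord0 i * v ord0 j|.
  have S0 : 0 <= S by apply: sumr_ge0 => i _; apply: sumr_ge0.
  have e0 : 0 < - bform X v v / (S + 1) by rewrite divr_gt0 ?oppr_gt0 // ltr_wpDl.
  have [k [_ Xk [_ X0] _]] := approx _ e0.
  have := bform_perturb v (fun i j => ltW (Xk i j)); rewrite -/S.
  have := X0 v; set b := bform X v v in v0 e0 *; set d := bform _ v v => d0.
  have -> : - b / (S + 1) * S = - b + b / (S + 1) by field; rewrite gt_eqF // ltr_wpDl.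
  by move: e0; rewrite mulNr; lra.
move=> i; split; apply/eqP; rewrite -subr_eq0; apply/eqP; apply: small => eps
  /approx[k [sk Xk _ XsE]].
  have := sk (dg i); have := Xk i i; rewrite (XsE i).1 !ltr_norml ler_norml =>
    /andP[? ?] /andP[? ?].
  by apply/andP; split; lra.
have := sk (eg i); have := Xk i (ordS i); rewrite (XsE i).2 !ltr_norml ler_norml =>
  /andP[? ?] /andP[? ?].
by apply/andP; split; lra.
Qed.

Lemma psd_closure_cycle_cone s X : (1 < m)%N ->
  psdmx X -> completes X s -> closure (@cycle_cone R m) s.
Proof.
move=> m1 [Xs X0] XE U /nbhs_ballP[eps /= eps0 sub].
(* Adding [eps / 2] to the diagonal makes the completion definite and stays in the ball. *)
pose s' : 'rV[R]_(m + m) := row_mx (lsubmx s + const_mx (eps / 2)) (rsubmx s).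
have s'd i : s' ord0 (dg i) = s ord0 (dg i) + eps / 2 by rewrite row_mxEl !mxE.
have s'e i : s' ord0 (eg i) = s ord0 (eg i) by rewrite row_mxEr !mxE.
exists s'; split; last first.
  apply: sub; split=> [//|i j]; rewrite (ord1 i); case: (split_ordP j) => k ->.
    rewrite -[lshift m k]/(dg k) /ball /= s'd opprD addrA subrr sub0r normrN gtr0_norm; lra.
  by rewrite -[rshift m k]/(eg k) /ball /= s'e subrr normr0.
exists (X + (eps / 2)%:M); split.
  split; first by rewrite linearD /= Xs tr_scalar_mx.
  move=> v vN0; rewrite mulmxDr mulmxDl mxE.
  apply: (lt_le_trans _ (lerD (X0 v) (lexx _))); rewrite add0r.
  rewrite mul_mx_scalar -scalemxAl mxE mulr_gt0 ?divr_gt0 // mxE.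
  rewrite lt_neqAle sumr_ge0 ?andbT => [|i _]; last by rewrite mxE -expr2 sqr_ge0.
  apply: contra vN0 => /eqP/esym/eqP; rewrite psumr_eq0 => [/allP v0|i _]; last first.
    by rewrite mxE -expr2 sqr_ge0.
  apply/eqP/rowP => i; rewrite mxE; have := v0 i (mem_index_enum i).
  by rewrite mxE -expr2 sqrf_eq0 => /eqP.
move=> i; rewrite s'd s'e !mxE eqxx mulr1n (XE i).1 (XE i).2.
by rewrite eq_sym (negbTE (ordS_neq i m1)) addr0.
Qed.

End Closure.

(** * Boundary points given by planar chains *)

Section BoundaryPieces.
Variables (R : realType) (m : nat).
Hypothesis m2 : (2 < m)%N.
Implicit Types (s : 'rV[R]_(m + m)) (X : 'M[R]_m).
Local Notation e j := (delta_mx ord0 j : 'rV[R]_m).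

Lemma posdef_psd X : posdefmx X -> psdmx X.
Proof.
move=> [Xs X0]; split=> // v; have [->|/X0/ltW//] := eqVneq v 0.
by rewrite /bform !mul0mx mxE.
Qed.

Lemma posdef_minor2 X j k : posdefmx X -> j != k -> 0 < minor2 X j k.
Proof.
move=> Xp jk; apply: minor2_gt0 (posdef_psd Xp) _ => x y.
set v := (X in bform _ X X); have [v0 _|/Xp.2 v0 E] := eqVneq v 0.
  have := congr1 (fun v : 'rV_m => v ord0 j) v0; have := congr1 (fun v : 'rV_m => v ord0 k) v0.
  rewrite !mxE !eqxx (negbTE jk) eq_sym (negbTE jk) /= !(mulr0, mulr1, addr0, add0r).
  by [].
by move: v0; rewrite -/(bform X v v) E ltxx.
Qed.

Lemma psd_boundary s X : psdmx X -> completes X s -> ~ cycle_cone s -> cycle_cone_boundary s.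
Proof. by move=> Xp XE nc; split=> //; apply: psd_closure_cycle_cone XE => //; apply: ltnW. Qed.

Lemma minor_not_cone s i :
  s ord0 (eg i) ^+ 2 = s ord0 (dg i) * s ord0 (dg (ordS i)) -> ~ cycle_cone s.
Proof.
move=> E [X [Xp XE]]; have := posdef_minor2 Xp (j := i) (k := ordS i).
rewrite eq_sym ordS_neq ?(ltnW m2) // => /(_ isT).
by rewrite /minor2 (XE i).1 (XE i).2 (XE (ordS i)).1 E subrr ltxx.
Qed.

(** The strict triangle inequality on the sphere: [acos a < acos b + th <= A + th]. The last
    hypothesis is the Gram determinant of three unit vectors, equal to
    [(1 - b^2) (1 - c^2) - (a - b c)^2] with [c = cos th]. *)
Lemma angle_step (A th a b : R) : 0 <= A -> 0 < th -> A + th <= pi ->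
  `|b| <= 1 -> cos A <= b -> 
  0 < 1 + 2 * a * b * cos th - a ^+ 2 - b ^+ 2 - cos th ^+ 2 -> cos (A + th) < a.
Proof.
move=> A0 th0 Ath b1 Ab det; rewrite ler_norml in b1.
have bK : cos (acos b) = b by rewrite acosK // in_itv.
have phi0 := acos_ge0 b1; have phipi := acos_lepi b1.
have phiA : acos b <= A by rewrite -ler_cos ?bK //; apply/andP; split; lra.
apply: (@le_lt_trans _ _ (cos (acos b + th))).
  by rewrite ler_cos ?lerD2r //; apply/andP; split; lra.
rewrite cosD bK; have s1 : 0 <= sin (acos b) by apply: sin_ge0_pi; rewrite phi0.
have s2 : 0 <= sin th by apply: sin_ge0_pi; apply/andP; split; lra.
have := sin2cos2 (acos b); have := sin2cos2 th; rewrite bK => e2 e1.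
set c := cos th in det e2 *; set p := sin (acos b) in s1 e1 *; set q := sin th in s2 e2 *.
have pq : (a - b * c) ^+ 2 < (p * q) ^+ 2.
  by rewrite exprMn e1 e2; lra.
rewrite -subr_gt0; have := pq; rewrite -(ltr_sqrt _ _) ?sqrtr_sqr; last first.
  by apply: le_lt_trans pq; exact: sqr_ge0.
by rewrite (ger0_norm (mulr_ge0 s1 s2)) ltr_norml => /andP[? _]; lra.
Qed.

Lemma gram_posdef_det X (t : 'I_m -> R) (j k l : 'I_m) : posdefmx X ->
  (forall i, 0 < t i) -> (forall i, X i i = t i ^+ 2) -> j != k -> j != l -> k != l ->
  let g p q := X p q / (t p * t q) in
  `|g j k| <= 1 /\ 
  0 < 1 + 2 * g j l * g j k * g k l - g j l ^+ 2 - g j k ^+ 2 - g k l ^+ 2.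
Proof.
move=> Xp t0 Xt jk jl kl g.
have sym p q : X p q = X q p by rewrite -[in LHS]Xp.1 mxE.
have XE p q : X p q = g p q * (t p * t q) by rewrite /g divfK // mulf_neq0 // gt_eqF.
have b1 : g j k ^+ 2 < 1.
  have := posdef_minor2 Xp jk; rewrite /minor2 !Xt XE exprMn [(_ * t k) ^+ 2]exprMn.
  have : 0 < t j ^+ 2 * t k ^+ 2 by rewrite mulr_gt0 // exprn_gt0.
  nra.
split; first by rewrite -(@ler_sqr _ _ 1) ?nnegrE // expr1n -normrX ger0_norm ?sqr_ge0 // ltW.
set a := g j l; set b := g j k in b1 *; set c := g k l.
(* The coefficients are the cofactors of the last row of the normalised Gram matrix, so the form at
   [v] is [1 - b ^+ 2] times the determinant. *)
pose v := ((b * c - a) / t j) *: e j + ((a * b - c) / t k) *: e k + ((1 - b ^+ 2) / t l) *: e l.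
have vN0 : v != 0.
  apply/eqP => /(congr1 (fun v : 'rV_m => v ord0 l)); rewrite !mxE.
  rewrite !eqxx [l == j]eq_sym [l == k]eq_sym (negbTE jl) (negbTE kl) /= !mulr0 !add0r mulr1.
  by apply/eqP; rewrite mulf_neq0 ?invr_eq0 ?gt_eqF // subr_gt0.
have := Xp.2 _ vN0; rewrite -/(bform X v v) /v !bformE (sym l j) (sym l k) (sym k j) !Xt !XE.
rewrite -/a -/b -/c => pos.
have {pos} : 0 < (1 - b ^+ 2) * (1 + 2 * a * b * c - a ^+ 2 - b ^+ 2 - c ^+ 2).
  apply: (lt_le_trans pos); rewrite le_eqVlt; apply/orP; left; apply/eqP.
  by field; rewrite !gt_eqF.
by rewrite pmulr_rgt0 ?subr_gt0.
Qed.

Section SumPiece.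
Variables (t th : 'I_m -> R) (o : 'I_m).
Hypotheses (t0 : forall i, 0 < t i) (th0 : forall i, i != o -> 0 < th i).
Hypotheses (tho : th o = \sum_(i | i != o) th i) (thpi : th o <= pi).

(** The path starts at the successor of [o] and ends at [w m.-1 = o]; the edge [o] closes it. [A k]
    is the total angle from [w 0] to [w k] along the path. *)
Local Notation w k := (iter k (@ordS m) (ordS o)).
Let A k := \sum_(l < k) th (w l).

Let w_last : w m.-1 = o.
Proof. by rewrite -iterSr prednK ?(ltn_trans _ m2) //; apply: val_inj;
  rewrite /= val_iter_ordS modnDr modn_small. Qed.

Let w_inj k l : (k < m)%N -> (l < m)%N -> w k = w l -> k = l.
Proof.
have main p q : (p <= q)%N -> (q < m)%N -> w p = w q -> p = q.
  move=> pq qm; rewrite -(subnK pq) iterD => /esym/eqP.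
  have [-> //|qp0] := posnP (q - p); rewrite (negbTE (iter_ordS_neq _ _)) // qp0 /=.
  by apply: leq_ltn_trans qm; exact: leq_subr.
by move=> km lm E; have [kl|/ltnW lk] := leqP k l; [apply: main | apply/esym/main].
Qed.

Let w_neq k : (k < m.-1)%N -> w k != o.
Proof.
move=> km; apply/eqP => E; have := w_inj _ _ (etrans E (esym w_last)).
by move: km m2; clear; lia.
Qed.

Let A_last : A m.-1 = th o.
Proof.
rewrite tho; pose ww (i : 'I_m) := w i.
have ww_inj : injective ww by move=> i j /w_inj E; apply: val_inj; exact: E.
rewrite (reindex_inj ww_inj) /= /A.
have mE : m = m.-1.+1 by rewrite prednK // (ltn_trans _ m2).
have recr (P : pred nat) (F : nat -> R) : \sum_(0 <= l < m | P l) F l =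
    \sum_(0 <= l < m.-1 | P l) F l + (if P m.-1 then F m.-1 else 0).
  by rewrite {1}mE big_mkcond big_nat_recr //= -big_mkcond.
rewrite -(big_mkord xpredT (fun l => th (w l))).
rewrite -(big_mkord (fun l => w l != o) (fun l => th (w l))).
rewrite recr w_last eqxx addr0 big_nat_cond [RHS]big_nat_cond.
by apply: eq_bigl => l; rewrite andbT; case: (ltnP l m.-1) => //= /w_neq ->.
Qed.

Let A_pi k : (k <= m.-1)%N -> 0 <= A k <= pi.
Proof.
move=> km; have pos l : (l < m.-1)%N -> 0 <= th (w l) by move=> lm; rewrite ltW ?th0 ?w_neq.
rewrite sumr_ge0 => [|l _]; last by apply: pos; apply: leq_trans (ltn_ord l) km.
apply: le_trans thpi; rewrite -A_last /A -!(big_mkord xpredT (fun l => th (w l))).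
rewrite [X in _ <= X](big_cat_nat (leq0n k) km) //=.
by rewrite lerDl big_nat sumr_ge0 // => l /andP[_]; exact: pos.
Qed.

Definition planar_point : 'rV[R]_(m + m) :=
  row_mx (\row_i t i ^+ 2) (\row_i (t i * t (ordS i) * cos (th i))).

Lemma planar_point_dg i : planar_point ord0 (dg i) = t i ^+ 2.
Proof. by rewrite row_mxEl mxE. Qed.

Lemma planar_point_eg i : planar_point ord0 (eg i) = t i * t (ordS i) * cos (th i).
Proof. by rewrite row_mxEr mxE. Qed.

(** In a definite completion, the angle between [w 0] and [o] would be strictly less than the sum
    along the path, which is [th o], whereas the edge [o] prescribes exactly [th o]. *)
Lemma planar_point_not_cone : ~ cycle_cone planar_point.
Proof.
move=> [X [Xp XE]].
have Xt i : X i i = t i ^+ 2 by rewrite (XE i).1 planar_point_dg.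
pose g p q := X p q / (t p * t q).
have gS i : g i (ordS i) = cos (th i).
  rewrite /g (XE i).2 planar_point_eg mulrAC divff ?mul1r //.
  by rewrite mulf_neq0 // gt_eqF.
have step k : (0 < k < m.-1)%N -> cos (A k) <= g (w 0) (w k) -> cos (A k.+1) < g (w 0) (w k.+1).
  move=> /andP[k0 km] IH; rewrite /A big_ord_recr /=.
  have [N1 N2 N3] : [/\ w 0 != w k, w 0 != w k.+1 & w k != w k.+1].
    by split; apply/eqP => /w_inj E; have := E _ _; move: k0 km; clear; lia.
  have [b1 det] := gram_posdef_det Xp t0 Xt N1 N2 N3.
  have /andP[Ak0 _] := A_pi (ltnW km).
  have /andP[_] := A_pi km; rewrite /A big_ord_recr /= => AS.
  apply: (angle_step Ak0 (th0 (w_neq km)) AS b1 IH).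
  by move: det; rewrite /= -/(g _ _) -/(g _ _) -/(g _ _) (gS (w k)).
have weak k : (k < m.-1)%N -> cos (A k.+1) <= g (w 0) (w k.+1).
  elim: k => [_|k IH km]; first by rewrite /A big_ord1 gS.
  by apply/ltW/step; [apply/andP; split=> // | apply: IH; apply: ltnW].
(* The first edge of the path gives only an equality; strictness is taken from the last step, which
   exists as [m > 2]. *)
pose k := (m - 3)%N; have [k1 k2] : (k.+2 = m.-1)%N /\ (k < m.-1)%N.
  by rewrite /k; move: m2; clear; lia.
have := step k.+1 _ (weak k k2); rewrite k1 => /(_ _); rewrite -k1 ltnS leqnn => /(_ isT).
rewrite k1.
rewrite A_last w_last /g.
have -> : X (ordS o) o = X o (ordS o) by rewrite -[in LHS]Xp.1 mxE.
by rewrite [t (ordS o) * _]mulrC -/(g _ _) gS ltxx.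
Qed.

(** The Gram matrix of the plane vectors of length [t v] and polar angle [al v]; the closing edge
    has angle [A m.-1 - A 0 = th o]. *)
Lemma planar_point_psd : exists2 X, psdmx X & completes X planar_point.
Proof.
have idx_exists v : exists k, (k < m)%N /\ w k = v.
  by have [k km E] := ordS_iter_onto (ordS o) v; exists k.
have [idx idxP] := choice idx_exists.
have idxE k : (k < m)%N -> idx (w k) = k.
  by move=> km; have [lt E] := idxP (w k); exact: w_inj.
pose al v := A (idx v).
have alS i : cos (al i - al (ordS i)) = cos (th i).
  have [im iE] := idxP i.
  have [->|io] := eqVneq i o.
    rewrite /al -{1}w_last idxE; last by move: m2; clear; lia.
    rewrite (idxE 0%N) ?A_last; last by move: m2; clear; lia.
    by rewrite /A big_ord0 subr0.
  have km : (idx i < m.-1)%N.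
    rewrite ltn_neqAle; apply/andP; split; last by move: im m2; clear; lia.
    by apply: contra io => /eqP E; rewrite -iE E w_last.
  have -> : al (ordS i) = al i + th i.
    rewrite /al -{1}iE -iterS idxE; last by move: km; clear; lia.
    by rewrite /A big_ord_recr /= iE.
  by rewrite opprD addrA subrr sub0r cosN.
pose U : 'rV[R]_m := \row_i (t i * cos (al i)); pose V : 'rV[R]_m := \row_i (t i * sin (al i)).
pose X := U^T *m U + V^T *m V.
have sq (W v : 'rV[R]_m) : bform (W^T *m W) v v = (v *m W^T) ord0 ord0 ^+ 2.
  rewrite /bform mulmxA -mulmxA; set a := v *m W^T.
  have -> : W *m v^T = a^T by rewrite trmx_mul trmxK.
  by rewrite [a]mx11_scalar tr_scalar_mx -scalar_mxM !mxE mulr1n expr2.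
have XE i j : X i j = t i * t j * cos (al i - al j).
  by rewrite !mxE !big_ord1 !mxE cosB; ring.
exists X.
  split; first by rewrite /X linearD /= !trmx_mul !trmxK.
  by move=> v; rewrite /bform /X mulmxDr mulmxDl mxE addr_ge0 // [X in 0 <= X]sq sqr_ge0.
move=> i; rewrite planar_point_dg planar_point_eg !XE subrr cos0 mulr1 expr2; split=> //.
by rewrite alS.
Qed.

Lemma planar_point_boundary : cycle_cone_boundary planar_point.
Proof.
by have [X Xp XE] := planar_point_psd; apply: psd_boundary XE planar_point_not_cone.
Qed.

End SumPiece.

Lemma psd_near_diag X : X^T = X -> (forall i, 1 <= X i i) ->
  (forall i j, i != j -> `|X i j| <= m%:R^-1) -> psdmx X.
Proof.
move=> Xs Xd Xo; split=> // v; rewrite bformE_sum.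
have m0 : (m%:R : R) != 0 by rewrite pnatr_eq0; move: m2; clear; lia.
have mV : 0 <= (m%:R : R)^-1 by rewrite invr_ge0 ler0n.
(* Diagonal dominance: each term of the form is at least the corresponding term of this vanishing
   sum, since [2 |v_i v_j| <= v_i^2 + v_j^2]. *)
suff S0 : \sum_i \sum_j ((i == j)%:R * v ord0 i ^+ 2 -
    m%:R^-1 * ((v ord0 i ^+ 2 + v ord0 j ^+ 2) / 2)) = 0.
  rewrite -[leLHS]S0; apply: ler_sum => i _; apply: ler_sum => j _.
  case: eqVneq => [<-|ij]; rewrite ?mul1r ?mul0r.
    have := Xd i; have := sqr_ge0 (v ord0 i).
    have : 0 <= m%:R^-1 * v ord0 i ^+ 2 by rewrite mulr_ge0 ?sqr_ge0.
    nra.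
  have := Xo i j ij; rewrite ler_norml; move: (X i j) (v ord0 i) (v ord0 j) mV (m%:R^-1 : R).
  move=> x a b _ mu /andP[x1 x2].
  have : 0 <= (mu + x) * (a + b) ^+ 2 + (mu - x) * (a - b) ^+ 2.
    by rewrite addr_ge0 // mulr_ge0 ?sqr_ge0 //; lra.
  nra.
transitivity (\sum_i (v ord0 i ^+ 2 -
    m%:R^-1 * ((m%:R * v ord0 i ^+ 2 + \sum_j v ord0 j ^+ 2) / 2))).
  apply: eq_bigr => i _; rewrite sumrB; congr (_ - _).
    rewrite (bigD1 i) //= eqxx mul1r big1 ?addr0 // => j ji.
    by rewrite eq_sym (negbTE ji) mul0r.
  rewrite -mulr_sumr -mulr_suml big_split /= sumr_const card_ord mulr_natl.
  by [].
rewrite sumrB -mulr_sumr -mulr_suml big_split /= -mulr_sumr sumr_const card_ord -mulr_natl.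
by field.
Qed.

End BoundaryPieces.

(** * Boundary points on an edge minor *)

Section MinorPiece.
Variables (R : realType) (m : nat).
Hypothesis m3 : (3 < m)%N.
Implicit Types (s : 'rV[R]_(m + m)) (X : 'M[R]_m).

(* The completion identifies the vertices [i] and [i + 1], up to a scalar; as
   [m >= 4], the contracted graph is still a simple cycle. *)
Lemma minor_piece_boundary s i :
  (forall k, 1 <= s ord0 (dg k) <= 2) ->
  (forall k, k != i -> `|s ord0 (eg k)| <= (2 * m%:R)^-1) ->
  s ord0 (eg i) ^+ 2 = s ord0 (dg i) * s ord0 (dg (ordS i)) ->
  cycle_cone_boundary s.
Proof.
move=> sd se Ew; have m2 : (2 < m)%N := ltnW m3; have m1 : (1 < m)%N := ltnW m2.
have m0 : 0 < (m%:R : R) by rewrite ltr0n; move: m1; clear; lia.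
pose j := ordS i; pose l := ordS j.
have [ij il jl] : [/\ i != j, i != l & j != l].
  by split; rewrite eq_sym; [apply: ordS_neq | apply: ordS2_neq | apply: ordS_neq].
(* This is where a triangle is excluded: the pair [{l, i}], which receives the contracted edge, must
   not already be the edge following [l]. *)
have liS : ordS l != i by apply: ordS3_neq.
set w := s ord0 (eg i) in Ew.
pose y k := s ord0 (dg k); pose f k := s ord0 (eg k).
have y1 k : 1 <= y k by have /andP[] := sd k.
have y2 k : y k <= 2 by have /andP[] := sd k.
have w1 : 1 <= `|w|.
  rewrite -(@ler_sqr _ 1) ?nnegrE // expr1n -normrX ger0_norm ?sqr_ge0 // Ew.
  by rewrite -[leLHS](mulr1 1); apply: ler_pM (y1 i) (y1 j).
have w0 : w != 0 by rewrite -normr_gt0 (lt_le_trans ltr01).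
(* The vector of [j] will be [w / y i] times that of [i], so this product of [i] and [l] gives [j]
   and [l] the product [f j]. As [y i <= 2 <= 2 * |w|], it is at most [1 / m]. *)
pose gl := f j * y i / w.
(* The contracted cycle, with [j] as an isolated vertex; [B] below replaces [j] by the multiple
   [w / y i] of [i]. *)
pose X0 : 'M[R]_m := \matrix_(p, q)
  if p == q then y p else
  if ((p == i) && (q == l)) || ((p == l) && (q == i)) then gl else
  if (p == j) || (q == j) then 0 else
  if q == ordS p then f p else if p == ordS q then f q else 0.
have X0p : psdmx X0.
  apply: (psd_near_diag m2).
  - apply/matrixP => p q; rewrite !mxE eq_sym; case: eqVneq => [->//|pq].
    rewrite orbC andbC [(q == i) && _]andbC [(q == j) || _]orbC.
    case: ifP => // _; case: ifP => // _; case: eqVneq => [E|//]; case: eqVneq => // E'.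
    by move: (ordS2_neq q m2); rewrite -E -E' eqxx.
  - by move=> p; rewrite mxE eqxx.
  have small k : k != i -> `|f k| <= m%:R^-1.
    move=> /se /le_trans; apply; rewrite lef_pV2 ?posrE ?mulr_gt0 //.
    by rewrite ler_peMl ?ler1n // ltW.
  move=> p q pq; rewrite mxE (negbTE pq); case: ifP => _.
    rewrite /gl !normrM normfV ler_pdivrMr ?(lt_le_trans _ w1) //.
    apply: (@le_trans _ _ m%:R^-1); last by rewrite ler_peMr // invr_ge0 ltW.
    rewrite [leRHS](_ : _ = (2 * m%:R)^-1 * 2); last by field; rewrite gt_eqF.
    rewrite ler_pM // ?(ger0_norm (le_trans ler01 (y1 i))) // se // eq_sym //.
  case: ifP => [_|/negbT]; first by rewrite normr0 invr_ge0 ltW.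
  rewrite negb_or => /andP[pj qj].
  have mV : 0 <= (m%:R : R)^-1 by rewrite invr_ge0 ltW.
  case: eqP => [E|_]; first by apply: small; apply: contra qj => /eqP pi; rewrite E pi.
  case: eqP => [E|_]; last by rewrite normr0.
  by apply: small; apply: contra pj => /eqP qi; rewrite E qi.
pose c k := if k == j then w / y i else 1.
pose pj k := if k == j then i else k.
pose B : 'M[R]_m := \matrix_(k, p) (c k * (pj k == p)%:R).
pose X := B *m X0 *m B^T.
have XE k q : X k q = c k * c q * X0 (pj k) (pj q).
  have rB r : row r B = c r *: delta_mx ord0 (pj r).
    by apply/rowP => p; rewrite !mxE eqxx eq_sym.
  rewrite -(bform_delta X) /bform /X !mulmxA -rowE -!mulmxA -trmx_mul -rowE !rB.
  by rewrite mulmxA -/(bform _ _ _) bformZl bformZr bform_delta mulrA.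
apply: (@psd_boundary _ _ m2 _ X); last by apply: minor_not_cone m2 _ _ Ew.
  split; first by rewrite /X !trmx_mul trmxK X0p.1 mulmxA.
  move=> v; have := X0p.2 (v *m B); rewrite /bform /X trmx_mul !mulmxA //.
have yi0 : y i != 0 by rewrite gt_eqF // (lt_le_trans ltr01).
move=> k; split.
  rewrite XE mxE eqxx /c /pj; case: eqVneq => [->|_]; last by rewrite !mul1r.
  by rewrite -/(y j); have := Ew; rewrite -/(y i) -/(y j) => E;
    rewrite mulrACA -expr2 E; field.
rewrite XE mxE /c /pj.
have [->|kj] := eqVneq k j.
  rewrite -/l (eq_sym l) (negbTE jl) (negbTE il) !eqxx /= mulr1 /gl.
  by rewrite -/(f j); field; rewrite yi0 w0.
have [E|Skj] := eqVneq (ordS k) j.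
  have -> : k = i by exact: can_inj (@ordSK m) _ _ E.
  by rewrite eqxx mul1r -/w; field.
have ki : k != i by apply: contra Skj => /eqP ->.
rewrite eq_sym (negbTE (ordS_neq k m1)) !mul1r (negbTE ki) /= (negbTE kj) (negbTE Skj) /= eqxx.
case: andP => // -[/eqP -> /eqP E].
by move: liS; rewrite E eqxx.
Qed.

End MinorPiece.

(** * Vanishing on all chains of angles, and on the boundary *)

Section Vanishing.
Variables (R : realType) (m : nat).
Hypothesis m3 : (3 < m)%N.
Variable o : 'I_m.
Hypothesis o0 : val o = 0%N.

Let m2 : (2 < m)%N := ltnW m3.
Let m1 : (1 < m)%N := ltnW m2.

Definition angle_sum (th : 'I_m -> R) : R := \sum_(i | i != o) th i.

Definition close_angles (th : 'I_m -> R) : 'I_m -> R :=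
  fun i => if i == o then angle_sum th else th i.

Lemma trig_poly_close_angles (th : 'rV[R]_m) (k i : 'I_m) :
  trig_poly (fun t => cos (close_angles (upd k t th ord0) i)).
Proof.
have ext f g : f =1 g -> trig_poly g -> trig_poly f.
  by move=> fg [A [B gE]]; exists A, B => t; rewrite fg.
have [->|io] := eqVneq i o; last first.
  have [E|ik] := eqVneq i k.
    apply: ext (trig_poly_cosD 0) => t.
    by rewrite /close_angles (negbTE io) updE E eqxx add0r.
  apply: ext (trig_polyC (cos (th ord0 i))) => t.
  by rewrite /close_angles (negbTE io) updE (negbTE ik).
have [->|ko] := eqVneq k o.
  apply: ext (trig_polyC (cos (angle_sum (th ord0)))) => t.
  rewrite /close_angles eqxx; congr cos; apply: eq_bigr => j jo.
  by rewrite updE (negbTE jo).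
apply: ext (trig_poly_cosD (\sum_(j | (j != o) && (j != k)) th ord0 j)) => t.
rewrite /close_angles eqxx /angle_sum (bigD1 k) //= updE eqxx addrC; congr (cos (_ + _)).
by apply: eq_bigr => j /andP[_ jk]; rewrite updE (negbTE jk).
Qed.

(** For angles in [[0, pi]], where [acos] inverts [cos], this is the hypothesis. Continuation to
    negative angles supplies all choices of signs. *)
Lemma hypersurface_angles (p : mvpoly m R) : vanishing_ideal (@cycle_hypersurface R m) p ->
  forall th : 'I_m -> R, pe (\row_i cos (close_angles th i)) p = 0.
Proof.
move=> p0 th.
pose F (th : 'rV[R]_m) := pe (\row_i cos (close_angles (th ord0) i)) p.
suff F0 : forall th, F th = 0.
  rewrite -(F0 (\row_i th i)) /F; congr (pe _ p); apply/rowP => i; rewrite !mxE; congr cos.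
  by rewrite /close_angles /angle_sum; case: eqP => _; rewrite ?mxE //;
    apply: eq_bigr => j _; rewrite mxE.
apply: (trig_poly_box0 (a := fun=> 0) (b := fun=> pi)).
- by move=> i; rewrite lexx pi_gt0.
- move=> x i; apply: (trig_poly_pe (x := fun t => \row_j cos (close_angles (upd i t x ord0) j))).
  move=> j; have [A [B E]] := trig_poly_close_angles x i j.
  by exists A, B => t; rewrite mxE E.
move=> x xpi; rewrite /F peE; apply: p0; split=> [i|i0 i00].
  by rewrite mxE cos_geN1 cos_le1.
have -> : i0 = o by apply: val_inj; rewrite i00 o0.
rewrite mxE /close_angles eqxx; congr cos; apply: eq_bigr => i io.
by rewrite mxE (negbTE io) cosK // in_itv /= xpi.
Qed.

Lemma boundary_angles (p : mvpoly (m + m) R) : vanishing_ideal (@cycle_cone_boundary R m) p ->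
  forall t th : 'I_m -> R, (forall i, 0 < t i) -> pe (planar_point t (close_angles th)) p = 0.
Proof.
move=> p0 t th t0.
pose F (th : 'rV[R]_m) := pe (planar_point t (close_angles (th ord0))) p.
suff F0 : forall th, F th = 0.
  rewrite -(F0 (\row_i th i)) /F; congr (pe _ p); congr row_mx.
  apply/rowP => i; rewrite !mxE; congr (_ * cos _).
  by rewrite /close_angles /angle_sum; case: eqP => _; rewrite ?mxE //;
    apply: eq_bigr => j _; rewrite mxE.
have m0 : 0 < (m%:R : R) by rewrite ltr0n; move: m1; clear; lia.
(* In this box the angles are positive and their sum is at most 1, hence at most [pi], as
   [planar_point_boundary] requires. *)
apply: (trig_poly_box0 (a := fun=> (2 * m%:R)^-1) (b := fun=> m%:R^-1)).
- move=> i; split; first by rewrite invr_ge0 mulr_ge0 // ltW.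
    by rewrite ltf_pV2 ?posrE ?mulr_gt0 // ltr_pMl // ltr1n.
  apply: (@le_trans _ _ 1); last by apply: le_trans (pi_ge2 R); rewrite ler1n.
  by rewrite invf_le1 // ler1n; move: m1; clear; lia.
- move=> x i; apply: (trig_poly_pe (x := fun t' => planar_point t (close_angles (upd i t' x ord0)))).
  move=> j; case: (split_ordP j) => l ->.
    have [A [B E]] := trig_polyC (t l ^+ 2).
    by exists A, B => t'; rewrite planar_point_dg; apply: E.
  have [A [B E]] := trig_polyM (trig_polyC (t l * t (ordS l))) (trig_poly_close_angles x i l).
  by exists A, B => t'; rewrite planar_point_eg E.
move=> x xb; rewrite /F peE; apply: p0.
have co : close_angles (x ord0) o = angle_sum (x ord0) by rewrite /close_angles eqxx.
have ci i : i != o -> close_angles (x ord0) i = x ord0 i.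
  by move=> io; rewrite /close_angles (negbTE io).
apply: (@planar_point_boundary _ _ m2 t (close_angles (x ord0)) o) => //.
- move=> i io; rewrite ci //; have /andP[h _] := xb i; apply: lt_le_trans h.
  by rewrite invr_gt0 mulr_gt0.
- by rewrite co; apply: eq_bigr => i io; rewrite ci.
rewrite co; apply: (@le_trans _ _ (\sum_(i < m) m%:R^-1)).
  rewrite /angle_sum [leRHS](bigD1 o) //= -[leLHS]add0r.
  apply: lerD; first by rewrite invr_ge0 ltW.
  by apply: ler_sum => i _; have /andP[] := xb i.
rewrite sumr_const card_ord -[m%:R^-1 *+ m]mulr_natl mulfV ?gt_eqF //.
by apply: le_trans (pi_ge2 R); rewrite ler1n.
Qed.

Lemma pe_edge_minor (s : 'rV[R]_(m + m)) i :
  pe s (edge_minor R i) = s ord0 (dg i) * s ord0 (dg (ordS i)) - s ord0 (eg i) ^+ 2.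
Proof. by rewrite /edge_minor rmorphB rmorphM rmorphXn /= !peX. Qed.

Lemma boundary_polynomial_vanishes (G : mvpoly (m + m) R) : is_homogeneous_cycle_polynomial G ->
  vanishing_ideal (@cycle_cone_boundary R m) (cycle_boundary_polynomial G).
Proof.
move=> [G' [[_ G'0] [Q [_ _ GQ]]]] s [/closure_cycle_cone[X Xp XE] sN].
rewrite -peE /cycle_boundary_polynomial rmorphM rmorph_prod /=; apply/eqP.
rewrite mulf_eq0; apply/orP.
have [/existsP[i /eqP i0]|none] := boolP [exists i : 'I_m, pe s (edge_minor R i) == 0].
  by right; rewrite prodf_seq_eq0; apply/hasP; exists i; rewrite ?mem_index_enum // i0 /=.
left; have D i : 0 < minor2 X i (ordS i).
  rewrite lt_neqAle psd_minor2_ge0 // andbT eq_sym; apply: contra none => D0.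
  apply/existsP; exists i; rewrite pe_edge_minor.
  by move: D0; rewrite /minor2 !(XE _).1 (XE i).2.
have d0 i : 0 < s ord0 (dg i) by rewrite -(XE i).1; apply: minor2_pos_diag Xp (D i).
rewrite peE (GQ s d0) mulf_eq0; apply/orP; right.
have [[j ndeg]|deg] := pselect (exists j, ~ degenerate X j).
  have [|X' [X'p EX']] := cycle_posdef_completion m2 Xp D; first by exists j.
  by case: sN; exists X'; split=> // i; rewrite (EX' i).1 (EX' i).2.
have [|be [be0 beE]] := planar_cycle_angles m2 Xp D.
  by move=> j; apply: contrapT => nd; apply: deg; exists j.
rewrite -peE -(hypersurface_angles G'0 be); apply/eqP; congr (pe _ G').
apply/rowP => i; rewrite !mxE -(XE i).2 beE !(XE _).1.
rewrite mulrAC divff ?mul1r; last by rewrite sqrtr_eq0 -ltNge mulr_gt0.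
rewrite /close_angles; case: eqP => // ->.
have -> : be o = - angle_sum be.
  by apply/eqP; rewrite -addr_eq0 -be0 [X in _ == X](bigD1 o).
by rewrite cosN.
Qed.

End Vanishing.

(** * Edge minors *)

Section Minors.
Variables (R : realType) (m : nat).
Hypothesis m3 : (3 < m)%N.
Implicit Types (p q : mvpoly (m + m) R) (i j : 'I_m).

Let m2 : (2 < m)%N := ltnW m3.
Let m1 : (1 < m)%N := ltnW m2.

Lemma dg_eq i j : (dg i == dg j) = (i == j). Proof. exact: eq_lshift. Qed.
Lemma eg_eq i j : (eg i == eg j) = (i == j). Proof. exact: eq_rshift. Qed.
Lemma dg_eg i j : (dg i == eg j) = false. Proof. exact: eq_lrshift. Qed.
Lemma eg_dg i j : (eg i == dg j) = false. Proof. exact: eq_rlshift. Qed.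
Definition dgegE := (dg_eq, eg_eq, dg_eg, eg_dg).

(* The parametrization [s_ii = a^2], [s_jj = b^2], [s_ij = a b] of the zeros of
   the minor of the edge [{i, j}], whose kernel is a prime ideal. *)
Definition minor_map i : {rmorphism mvpoly (m + m) R -> mvpoly (m + m) R} :=
  psubst (fun k => if k == eg i then mvar R (dg i) * mvar R (dg (ordS i))
                   else if (k == dg i) || (k == dg (ordS i)) then mvar R k ^+ 2 else mvar R k).

Definition minor_pt i (x : 'rV[R]_(m + m)) : 'rV[R]_(m + m) :=
  \row_k if k == eg i then x ord0 (dg i) * x ord0 (dg (ordS i))
         else if (k == dg i) || (k == dg (ordS i)) then x ord0 k ^+ 2 else x ord0 k.

Lemma pe_minor_map i x p : pe x (minor_map i p) = pe (minor_pt i x) p.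
Proof.
rewrite pe_psubst; congr (pe _ p); apply/rowP => k; rewrite !mxE.
by case: ifP => _; [|case: ifP => _]; rewrite ?rmorphM ?rmorphXn /= !peX.
Qed.

Lemma minor_map_edge_minor i j : (minor_map i (edge_minor R j) == 0) = (j == i).
Proof.
apply/eqP/eqP => [E|->]; last first.
  apply: pe_eq0 => x; rewrite pe_minor_map pe_edge_minor !mxE !dgegE !eqxx orbT /=.
  by rewrite exprMn subrr.
apply/eqP; apply: contraT => ji.
have [x [xd xe]] : exists x : 'rV[R]_(m + m), (forall k, x ord0 (dg k) = 1) /\
    (forall k, x ord0 (eg k) = 0).
  by exists (row_mx (const_mx 1) (const_mx 0)); split=> k; rewrite ?row_mxEl ?row_mxEr mxE.
have := congr1 (pe x) E; rewrite rmorph0 pe_minor_map pe_edge_minor !mxE !dgegE (negbTE ji) /=.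
rewrite !xd xe expr1n; do 2![case: ifP => _]; rewrite ?mulr1 ?mul1r expr0n subr0 => /eqP;
  by rewrite oner_eq0.
Qed.

(** Division by [X^2 - s_ii s_jj] in the variable [s_ij]. Both roots are reached by the
    parametrization: changing the sign of one parameter changes that of [s_ij]. *)
Lemma minor_map_dvd i p : minor_map i p = 0 -> exists K, p = K * edge_minor R i.
Proof.
move=> p0; pose c := mvar R (dg i) * mvar R (dg (ordS i)).
have size_T : size ('X^2 - c%:P : {poly mvpoly (m + m) R}) = 3%N by rewrite size_XnsubC.
have [||y [yi yS]|K pK] := @monic_dvd R (m + m) ('X^2 - c%:P) (in_var (eg i) p)
   (fun y => 0 < y ord0 (dg i) /\ 0 < y ord0 (dg (ordS i)))
   (fun y => let r := Num.sqrt (y ord0 (dg i)) * Num.sqrt (y ord0 (dg (ordS i))) in [:: r; - r]).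
- by rewrite monicE lead_coefXnsubC.
- move=> q q0; apply: (@pe_box_eq0 R _ q (fun=> 1) (fun=> 2)) => [k|x xb]; first by rewrite ltr1n.
  by apply: q0; split; apply: lt_le_trans (ltr01) _;
    [have /andP[] := xb (dg i) | have /andP[] := xb (dg (ordS i))].
- set r := _ * _; have r0 : 0 < r by rewrite mulr_gt0 // sqrtr_gt0.
  have r2 : r ^+ 2 = y ord0 (dg i) * y ord0 (dg (ordS i)).
    by rewrite exprMn !sqr_sqrtr // ltW.
  split; rewrite ?size_T //.
    by rewrite /= inE andbT; apply/eqP; move: r0; lra.
  have key (eps : R) : eps ^+ 2 = 1 -> (map_poly (pe y) ('X^2 - c%:P)).[eps * r] = 0 /\
      (map_poly (pe y) (in_var (eg i) p)).[eps * r] = 0.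
    move=> eps2; split.
      rewrite rmorphB /= map_polyXn map_polyC hornerD hornerN hornerXn hornerC /=.
      by rewrite exprMn eps2 mul1r r2 rmorphM /= !peX subrr.
    rewrite horner_map_in_var.
    pose x := upd (dg i) (eps * Num.sqrt (y ord0 (dg i)))
                (upd (dg (ordS i)) (Num.sqrt (y ord0 (dg (ordS i)))) y).
    have Sii : ordS i == i = false by apply/negbTE/ordS_neq.
    have -> : upd (eg i) (eps * r) y = minor_pt i x.
      apply/rowP => k; rewrite !mxE !dgegE !eqxx Sii mulrA; case: ifP => // _.
      case: eqP => [->|_] /=; first by rewrite exprMn eps2 mul1r sqr_sqrtr // ltW.
      by case: eqP => [->|//]; rewrite sqr_sqrtr // ltW.
    by rewrite -pe_minor_map p0 rmorph0.
  move=> z; rewrite !inE => /orP[] /eqP ->.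
    by have := key 1 (expr1n _ _); rewrite mul1r.
  by have := key (-1); rewrite sqrrN expr1n mulN1r => /(_ erefl).
exists (- K.[mvar R (eg i)]); have := congr1 (horner^~ (mvar R (eg i))) pK.
rewrite /= horner_in_var hornerM hornerD hornerN hornerXn hornerC => {1}->.
by rewrite /edge_minor mulNr -mulrN opprB.
Qed.

(** After division by one minor, the quotient stays in the kernels of the other maps: these kernels
    are prime and do not contain that minor. *)
Lemma prod_minors_dvd (s : seq 'I_m) p : uniq s -> (forall i, i \in s -> minor_map i p = 0) ->
  exists K, p = K * \prod_(i <- s) edge_minor R i.
Proof.
elim: s p => [p _ _|i s IH p /= /andP[si us] p0].
  by exists p; rewrite big_nil mulr1.
have [K pK] := minor_map_dvd (p0 i (mem_head _ _)).
have [j js|K' KK'] := IH K us; last by exists K'; rewrite big_cons pK KK' mulrAC mulrA.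
apply/eqP; have /eqP := p0 j (mem_behead (s := i :: s) js).
rewrite pK rmorphM /= mulf_eq0 minor_map_edge_minor => /orP[//|/eqP E].
by move: si; rewrite E js.
Qed.

Lemma boundary_minor_map i p : vanishing_ideal (@cycle_cone_boundary R m) p -> minor_map i p = 0.
Proof.
move=> p0; have m0 : 0 < (m%:R : R) by rewrite ltr0n; move: m1; clear; lia.
have M0 : 0 < (2 * m%:R : R)^-1 by rewrite invr_gt0 mulr_gt0.
(* The bound [5 / 4] keeps the squared parameters below 2, as [minor_piece_boundary] requires. *)
apply: (@pe_box_eq0 _ _ _ (fun k => if (k < m)%N then 1 else 0)
                      (fun k => if (k < m)%N then 5 / 4 else (2 * m%:R)^-1)).
  by move=> k; case: ifP => _ //; lra.
move=> x xb; have xd k : 1 <= x ord0 (dg k) <= 5 / 4 by have := xb (dg k); rewrite /= ltn_ord.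
have xe k : 0 <= x ord0 (eg k) <= (2 * m%:R)^-1.
  by have := xb (eg k); rewrite /= ltnNge leq_addr.
rewrite pe_minor_map peE; apply: p0; apply: (minor_piece_boundary m3 (i := i)).
- move=> k; rewrite !mxE !dgegE; case: ifP => _; have /andP[k1 k2] := xd k;
    by apply/andP; split; nra.
- move=> k ki; rewrite !mxE !dgegE (negbTE ki) /=; have /andP[k1 k2] := xe k.
  by rewrite ger0_norm.
by rewrite !mxE !dgegE !eqxx orbT /= exprMn.
Qed.

End Minors.

(** * The cycle polynomial *)

Section CyclePolynomial.
Variables (R : realType) (m : nat).
Hypothesis m3 : (3 < m)%N.
Variable o : 'I_m.
Hypothesis o0 : val o = 0%N.

Let m2 : (2 < m)%N := ltnW m3.
Let m1 : (1 < m)%N := ltnW m2.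

(** The edges other than [o] in increasing order, so that angles decreasing geometrically with the
    index form a superincreasing list. *)
Lemma edge_list : exists j l, [/\ uniq (j :: l), path ltn 0 (map val (j :: l)),
  forall i : 'I_m, (i \in j :: l) = (i != o) & size l = (m - 2)%N].
Proof.
pose L := [seq i <- enum 'I_m | i != o].
have L_uniq : uniq L by rewrite filter_uniq ?enum_uniq.
have L_mem i : (i \in L) = (i != o) by rewrite mem_filter mem_enum andbT.
have L_sorted : path ltn 0 (map val L).
  rewrite path_min_sorted; last first.
    apply/allP => _ /mapP[i iL ->]; move: iL.
    by rewrite L_mem -val_eqE /= o0 lt0n.
  have srt : sorted (relpre val ltn) (enum 'I_m).
    by rewrite -sorted_map val_enum_ord iota_ltn_sorted.
  rewrite sorted_map; apply: sorted_filter srt => a b c /=; exact: ltn_trans.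
have size_L : size L = (m - 1)%N.
  have -> : size L = #|predC1 o| by rewrite cardE /enum_mem -enumT /L; congr size; apply: eq_filter.
  by rewrite cardC1 card_ord subn1.
case: L L_uniq L_mem L_sorted size_L => [|j l] ? ? ? sz; last first.
  by exists j, l; split=> //; move: sz => /= ; lia.
by move: sz m1 => /=; lia.
Qed.

Variables (j : 'I_m) (l : seq 'I_m).
Hypotheses (jl_uniq : uniq (j :: l)) (jl_path : path ltn 0 (map val (j :: l))).
Hypotheses (jl_mem : forall i, (i \in j :: l) = (i != o)) (size_l : size l = (m - 2)%N).

Lemma big_edge_list (F : 'I_m -> R) : \sum_(i <- j :: l) F i = \sum_(i | i != o) F i.
Proof. by rewrite (big_uniq _ jl_uniq); apply: eq_bigl => i; rewrite jl_mem. Qed.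

Lemma prod_edge_list (F : 'I_m -> R) : \prod_(i <- j :: l) F i = \prod_(i | i != o) F i.
Proof. by rewrite (big_uniq _ jl_uniq); apply: eq_bigl => i; rewrite jl_mem. Qed.

(** With [i] the first index, the sum is less than [2 * 4^-i + 4^-i], which is below
    [4 * 4^-i <= 4^-n]. *)
Lemma superincreasing_geometric (s : seq 'I_m) (th : 'I_m -> R) n : path ltn n (map val s) ->
  (forall i, i \in s -> 4^-1 ^+ i <= th i <= 2 * 4^-1 ^+ i) ->
  superincreasing (map th s) /\ \sum_(i <- s) th i < 4^-1 ^+ n.
Proof.
have q0 k : 0 < (4^-1 : R) ^+ k by rewrite exprn_gt0 // invr_gt0.
elim: s n => [n _ _|i s IH n /= /andP[ni ps] th_s]; first by rewrite big_nil.
have [k ks|ss lt] := IH i ps; first by apply: th_s; rewrite inE ks orbT.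
have /andP[th1 th2] := th_s i (mem_head _ _); rewrite big_cons big_map ss andbT.
split; first exact: lt_le_trans lt th1.
have : (4^-1 : R) ^+ i <= 4^-1 * 4^-1 ^+ n.
  rewrite -exprS ler_wiXn2l ?invr_ge0 // invf_le1 // ler1n //.
have := q0 n; have := q0 i; lra.
Qed.

(** A box of cosines on which the angles are superincreasing; the coordinate [o] stays free. *)
Definition in_range (x : 'I_m -> R) :=
  forall i, i != o -> cos (2 * 4^-1 ^+ i) <= x i <= cos (4^-1 ^+ i).

Let range_itv (i : 'I_m) : i != o -> 0 < (4^-1 : R) ^+ i /\ 2 * (4^-1 : R) ^+ i <= pi.
Proof.
rewrite -val_eqE /= o0 => i0; split; first by rewrite exprn_gt0 // invr_gt0.
have : (4^-1 : R) ^+ i <= 4^-1 ^+ 1.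
  by rewrite ler_wiXn2l ?invr_ge0 ?invf_le1 ?ler1n // lt0n.
have := pi_ge2 R; rewrite expr1; lra.
Qed.

Lemma cos_range_lt (i : 'I_m) : i != o -> cos (2 * (4^-1 : R) ^+ i) < cos ((4^-1 : R) ^+ i).
Proof.
move=> /range_itv[a b]; rewrite ltr_cos ?in_itv /=; first by lra.
  by apply/andP; split; lra.
by apply/andP; split; lra.
Qed.

Lemma in_range_acos x : in_range x ->
  [/\ forall i, i != o -> cos (acos (x i)) = x i,
      superincreasing (map (acos \o x) (j :: l)) &
      \sum_(i <- j :: l) acos (x i) < pi].
Proof.
move=> xr; have x1 i : i != o -> -1 <= x i <= 1.
  move=> io; have /andP[a b] := xr i io; apply/andP; split.
    exact: le_trans (cos_geN1 _) a.
  exact: le_trans b (cos_le1 _).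
have th i : i \in j :: l -> 4^-1 ^+ i <= acos (x i) <= 2 * 4^-1 ^+ i.
  rewrite jl_mem => io; have [a b] := range_itv io.
  have i1 : 0 <= acos (x i) <= pi by rewrite acos_ge0 ?acos_lepi ?x1.
  have i2 : 0 <= (4^-1 : R) ^+ i <= pi by apply/andP; split; lra.
  have i3 : 0 <= 2 * (4^-1 : R) ^+ i <= pi by apply/andP; split; lra.
  by rewrite -(ler_cos i1 i2) -(ler_cos i3 i1) acosK ?in_itv /= ?x1 // andbC xr.
have [ss lt] := superincreasing_geometric (th := acos \o x) jl_path th.
split=> //; first by move=> i io; rewrite acosK // in_itv /= x1.
by apply: (lt_le_trans lt); have := pi_ge2 R; rewrite expr0; lra.
Qed.

Definition is_cos_sum_poly n (e q : 'I_m -> mvpoly n R) (T : {poly mvpoly n R}) :=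
  [/\ T \is monic, size T = (2 ^ size l).+1 &
  forall (phi : {rmorphism mvpoly n R -> R}) (sg th : 'I_m -> R),
    (forall i, i \in j :: l -> phi (e i) = sg i * cos (th i) /\ phi (q i) = sg i ^+ 2) ->
    (map_poly phi T).[(\prod_(i <- j :: l) sg i) * cos (\sum_(i <- j :: l) th i)] = 0].

(* The roots depend on [T] only through the scaling by the product of [sg]. *)
Lemma cos_sum_poly_split x : in_range x -> exists rs : seq R,
  [/\ size rs = (2 ^ size l)%N, forall z, z \in rs -> z < 1 &
  forall n e q T, @is_cos_sum_poly n e q T -> forall (y : 'rV[R]_n) (sg : 'I_m -> R),
    (forall i, i != o -> [/\ 0 < sg i, pe y (e i) = sg i * x i & pe y (q i) = sg i ^+ 2]) ->
    map_poly (pe y) T = \prod_(z <- rs) ('X - ((\prod_(i | i != o) sg i) * z)%:P)].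
Proof.
move=> xr; have [xK ss ltpi] := in_range_acos xr.
have [rs [rs_uniq rs_size rsP]] := cos_sum_roots ltr01 jl_uniq ss ltpi.
exists rs; split=> // [z /rsP[]//|n e q T [Tmon Tsize Troot] y sg sgP].
set c := \prod_(i | i != o) sg i; have c0 : 0 < c by apply: prodr_gt0 => i /sgP[].
have Tymon : map_poly (pe y) T \is monic by apply: monic_map.
have Tysize : size (map_poly (pe y) T) = (2 ^ size l).+1.
  by rewrite size_map_poly_id0 // (monicP Tmon) rmorph1 oner_eq0.
have cinj : injective ( *%R c) by apply: mulfI; rewrite gt_eqF.
rewrite -(big_map ( *%R c) xpredT (fun z => 'X - z%:P)).
rewrite (all_roots_prod_XsubC (p := map_poly (pe y) T) (rs := [seq c * z | z <- rs])).
- by rewrite (monicP Tymon) scale1r.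
- by rewrite size_map rs_size.
- apply/allP => _ /mapP[z /rsP[_ [th' fl ->]] ->]; rewrite rootE mul1r /c -prod_edge_list.
  apply/eqP/Troot => i; rewrite jl_mem => io; have [_ -> ->] := sgP i io; split=> //.
  by case: (fl i) => ->; rewrite ?cosN /= xK.
- by rewrite uniq_rootsE map_inj_uniq.
Qed.

Lemma in_range_dense (q : mvpoly m R) :
  (forall y : 'rV[R]_m, in_range (y ord0) -> pe y q = 0) -> q = 0.
Proof.
move=> q0; apply: (@pe_box_eq0 _ _ q (fun i => if i == o then 0 else cos (2 * 4^-1 ^+ i))
                                     (fun i => if i == o then 1 else cos (4^-1 ^+ i))).
  by move=> i; case: eqVneq => [_|/cos_range_lt//]; exact: ltr01.
by move=> x xb; apply: q0 => i io; have := xb i; rewrite (negbTE io).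
Qed.

Section Inhomogeneous.
Variable T : {poly mvpoly m R}.
Hypothesis HT : is_cos_sum_poly (fun i => mvar R i) (fun=> 1) T.

Lemma hypersurface_dvd (p : mvpoly m R) : vanishing_ideal (@cycle_hypersurface R m) p ->
  exists K, p = K * T.[mvar R o].
Proof.
move=> p0; have [Tmon Tsize Troot] := HT.
have [|y yr|K pK] := @cos_sum_dvd R _ m (fun i => mvar R i) (fun=> 1) j l T (in_var o p)
  (fun y => in_range (y ord0)) (fun _ _ => 1) (fun y i => acos (y ord0 i)) Tmon Tsize Troot jl_uniq.
- exact: in_range_dense.
- have [xK ss ltpi] := in_range_acos yr; split=> //.
    by move=> i; rewrite jl_mem => io; rewrite mul1r xK // peX rmorph1 expr1n.
  move=> th' fl; rewrite big1 // mul1r horner_map_in_var big_edge_list.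
  rewrite -[RHS](hypersurface_angles o0 p0 th'); congr (pe _ p).
  apply/rowP => i; rewrite !mxE /close_angles; case: eqVneq => // io.
  by case: (fl i) => ->; rewrite ?cosN xK.
by exists K.[mvar R o]; have := congr1 (horner^~ (mvar R o)) pK; rewrite /= horner_in_var hornerM.
Qed.

(** [T.[mvar R o]] divides the irreducible [G'] and is not a unit, since it vanishes where all
    angles are 0. *)
Lemma cycle_polynomial_assoc (G' : mvpoly m R) : is_cycle_polynomial G' ->
  exists2 c, c != 0 & G' = mpoly.mpolyC m c * T.[mvar R o].
Proof.
move=> [[_ _ irr] G'0]; have [K GK] := hypersurface_dvd G'0.
have [/unit_const[c c0 Kc]|TU] := irr _ _ GK; first by exists c; rewrite -?Kc.
have [Tmon Tsize Troot] := HT.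
have one_root : pe (const_mx 1) T.[mvar R o] = 0.
  have := Troot (pe (const_mx 1)) (fun=> 1) (fun=> 0).
  rewrite big1 // [\sum_(i <- _) _]big1 // cos0 mul1r pe_horner peX mxE; apply=> i _.
  by rewrite peX mxE rmorph1 ?mul1r ?cos0 ?expr1n.
by have := rmorph_unit (pe (const_mx 1)) TU; rewrite one_root unitr0.
Qed.

(** The coefficients of [T] might involve [x_o]; but on a dense set they are determined by the
    roots, which depend on the other coordinates only. *)
Lemma cos_sum_poly_indep (y : 'rV[R]_m) w :
  map_poly (pe (upd o w y)) T = map_poly (pe y) T.
Proof.
apply/polyP => k; rewrite !coef_map /=.
pose h i := if i == o then mpoly.mpolyC m w else mvar R i.
have subE y' : pe y' (psubst h T`_k) = pe (upd o w y') T`_k.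
  rewrite pe_psubst; congr (pe _ _); apply/rowP => i; rewrite !mxE /h.
  by case: ifP; rewrite ?peC ?peX.
rewrite -subE; suff -> : psubst h T`_k = T`_k by [].
apply/eqP; rewrite -subr_eq0; apply/eqP/in_range_dense => {}y yr.
have [rs [_ _ rsP]] := cos_sum_poly_split yr.
have TE (y' : 'rV[R]_m) : (forall i, i != o -> y' ord0 i = y ord0 i) ->
    map_poly (pe y') T = \prod_(z <- rs) ('X - (1 * z)%:P).
  move=> y'E; rewrite (rsP _ _ _ _ HT y' (fun=> 1)) ?big1_eq // => i io.
  by rewrite ltr01 peX rmorph1 mul1r expr1n y'E.
rewrite rmorphB /= subE -[pe (upd o w y) _]coef_map -[pe y _]coef_map (TE y) // TE ?subrr // => i io.
by rewrite updE (negbTE io).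
Qed.

(** Will show that no edge minor divides [G]. For [i = o], all roots are less than 1 on the range;
    otherwise [T] is monic in [x_o], which is free to vary. *)
Lemma cycle_polynomial_neq0_at_one i : exists z : 'rV[R]_m, z ord0 i = 1 /\ pe z T.[mvar R o] != 0.
Proof.
have [Tmon Tsize Troot] := HT.
have [->|io] := eqVneq i o.
  pose x : 'rV[R]_m := \row_k cos (4^-1 ^+ k).
  have xr : in_range (x ord0).
    by move=> k ko; rewrite mxE lexx ltW // cos_range_lt.
  have [rs [_ rs1 rsP]] := cos_sum_poly_split xr.
  exists (upd o 1 x); split; first by rewrite updE eqxx.
  rewrite pe_horner peX updE eqxx cos_sum_poly_indep.
  rewrite (rsP _ _ _ _ HT x (fun=> 1)) => [|k _]; last by rewrite ltr01 peX rmorph1 mul1r expr1n.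
  rewrite horner_prod prodf_seq_neq0; apply/allP => z /rs1 z1 /=.
  by rewrite big1_eq mul1r !hornerE subr_eq0 eq_sym lt_eqF.
apply: contrapT => none.
have : map_poly (pe (const_mx 1)) T = 0.
  apply: (@poly_itv0 _ _ 0 1) => // w _; apply: contrapT => /eqP Tw; apply: none.
  exists (upd o w (const_mx 1)); rewrite updE (negbTE io) mxE; split=> //.
  by rewrite pe_horner peX updE eqxx cos_sum_poly_indep.
by apply/eqP; rewrite monic_neq0 // monic_map.
Qed.

End Inhomogeneous.

(** * Homogenisation of the cosine polynomial *)

Section Homogeneous.

(** With [s_ii = a_i^2] and [s_(i,i+1) = x_i a_i a_(i+1)], this is a polynomial inverse of the
    substitution, free of square roots. *)
Definition weighted_pt (x : 'rV[R]_(m + m)) : 'rV[R]_(m + m) :=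
  row_mx (\row_i x ord0 (dg i) ^+ 2)
         (\row_i (x ord0 (eg i) * (x ord0 (dg i) * x ord0 (dg (ordS i))))).

Lemma weighted_pt_dg x i : weighted_pt x ord0 (dg i) = x ord0 (dg i) ^+ 2.
Proof. by rewrite row_mxEl mxE. Qed.

Lemma weighted_pt_eg x i :
  weighted_pt x ord0 (eg i) = x ord0 (eg i) * (x ord0 (dg i) * x ord0 (dg (ordS i))).
Proof. by rewrite row_mxEr mxE. Qed.

Lemma weighted_pt_poly (q : mvpoly (m + m) R) :
  exists q' : mvpoly (m + m) R, forall x, pe x q' = pe (weighted_pt x) q.
Proof.
exists (psubst (fun k => match fintype.split k with
  | inl i => mvar R (dg i) ^+ 2
  | inr i => mvar R (eg i) * (mvar R (dg i) * mvar R (dg (ordS i))) end) q) => x.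
rewrite pe_psubst; congr (pe _ q); apply/rowP => k; rewrite !mxE.
by case: fintype.split => i; rewrite ?rmorphXn ?rmorphM /= !mxE !peX // rmorphM /= !peX.
Qed.

Lemma cycle_subst_weighted (x : 'rV[R]_(m + m)) i : (forall i, 0 < x ord0 (dg i)) ->
  cycle_subst (weighted_pt x) ord0 i = x ord0 (eg i).
Proof.
move=> x0; rewrite mxE !weighted_pt_dg weighted_pt_eg -exprMn sqrtr_sqr ger0_norm.
  by rewrite mulfK // mulf_neq0 // gt_eqF.
by rewrite mulr_ge0 // ltW.
Qed.

Definition good_point (y : 'rV[R]_(m + m)) :=
  (forall i, 0 < y ord0 (dg i)) /\ in_range (cycle_subst y ord0).

Lemma good_point_dense (q : mvpoly (m + m) R) :
  (forall y, good_point y -> pe y q = 0) -> q = 0.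
Proof.
move=> q0; have [q' q'E] := weighted_pt_poly q.
have q'0 : q' = 0.
  apply: (@pe_box_eq0 _ _ q'
    (fun k => match fintype.split k with
       | inl i => 1
       | inr i => if i == o then 0 else cos (2 * 4^-1 ^+ i) end)
    (fun k => match fintype.split k with
       | inl i => 2
       | inr i => if i == o then 1 else cos (4^-1 ^+ i) end)).
    move=> k; case: fintype.split => i; first by rewrite ltr1n.
    by case: eqVneq => [_|/cos_range_lt//]; exact: ltr01.
  move=> x xb.
  have x0 i : 0 < x ord0 (dg i).
    by have /andP[h _] := xb (dg i); apply: lt_le_trans h; rewrite (unsplitK (inl i)).
  rewrite q'E; apply: q0; split=> [i|i io]; first by rewrite weighted_pt_dg exprn_gt0.
  rewrite cycle_subst_weighted //; have := xb (eg i).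
  by rewrite (unsplitK (inr i)) (negbTE io).
apply: (@pe_box_eq0 _ _ q (fun=> 1) (fun=> 2)) => [k|y yb]; first by rewrite ltr1n.
have y0 i : 0 < y ord0 (dg i) by have /andP[h _] := yb (dg i); apply: lt_le_trans h.
pose x : 'rV[R]_(m + m) := row_mx (\row_i Num.sqrt (y ord0 (dg i))) (cycle_subst y).
have -> : y = weighted_pt x.
  apply/rowP => k; case: (split_ordP k) => i ->.
    by rewrite weighted_pt_dg row_mxEl mxE sqr_sqrtr // ltW.
  rewrite weighted_pt_eg row_mxEr !row_mxEl !mxE sqrtrM ?(ltW (y0 i)) // divfK //.
  by rewrite mulf_neq0 // sqrtr_eq0 -ltNge.
by rewrite -q'E q'0 rmorph0.
Qed.

Variable T : {poly mvpoly (m + m) R}.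
Hypothesis HT : is_cos_sum_poly (fun i => mvar R (eg i))
  (fun i => mvar R (dg i) * mvar R (dg (ordS i))) T.

(** The product of the norms of the edges other than [o] is [delta] times the norm of [o]. So the
    scaled root [x_o] of [T] becomes [s_(o,o+1) * delta], the value substituted in [cone_poly]. *)
Definition delta : mvpoly (m + m) R := \prod_(i | (i != o) && (i != ordS o)) mvar R (dg i).

Definition cone_poly := T.[mvar R (eg o) * delta].

Definition edge_norm (y : 'rV[R]_(m + m)) i := Num.sqrt (y ord0 (dg i) * y ord0 (dg (ordS i))).

Let edge_norm_gt0 (y : 'rV[R]_(m + m)) i : (forall i, 0 < y ord0 (dg i)) -> 0 < edge_norm y i.
Proof. by move=> y0; rewrite sqrtr_gt0 mulr_gt0. Qed.

Lemma pe_delta y : pe y delta = \prod_(i | (i != o) && (i != ordS o)) y ord0 (dg i).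
Proof. by rewrite rmorph_prod; apply: eq_bigr => i _; rewrite /= peX. Qed.

Lemma prod_edge_norm (y : 'rV[R]_(m + m)) : (forall i, 0 < y ord0 (dg i)) ->
  \prod_(i | i != o) edge_norm y i = edge_norm y o * pe y delta.
Proof.
move=> y0; have So : ordS o != o by apply: ordS_neq.
have d0 : 0 <= pe y delta by rewrite pe_delta prodr_ge0 // => i _; rewrite ltW.
apply: (@pexpIrn R 2) => //; rewrite ?nnegrE ?mulr_ge0 ?sqrtr_ge0 //.
  by rewrite prodr_ge0 // => i _; exact: sqrtr_ge0.
rewrite exprMn sqr_sqrtr ?mulr_ge0 ?ltW // -prodrXl.
rewrite (eq_bigr (fun i => y ord0 (dg i) * y ord0 (dg (ordS i)))) => [|i _]; last first.
  by rewrite sqr_sqrtr // mulr_ge0 // ltW.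
rewrite big_split /= (bigD1 (ordS o)) //= -pe_delta.
have -> : \prod_(i | i != o) y ord0 (dg (ordS i)) = y ord0 (dg o) * pe y delta.
  transitivity (\prod_(i | i != ordS o) y ord0 (dg i)).
    rewrite [RHS](reindex_inj (@ordS_inj m)) /=; apply: eq_bigl => i.
    by rewrite (inj_eq (@ordS_inj m)).
  rewrite (bigD1 o) 1?eq_sym //= pe_delta; congr (_ * _).
  by apply: eq_bigl => i; rewrite andbC.
ring.
Qed.

Lemma boundary_cone_poly_dvd (p : mvpoly (m + m) R) :
  vanishing_ideal (@cycle_cone_boundary R m) p ->
  exists n K, delta ^+ n * p = K * cone_poly.
Proof.
move=> p0; have [Tmon Tsize Troot] := HT.
set P := in_var (eg o) p; set n := size P.
have [|y [y0 yr]|K pK] := @cos_sum_dvd R _ (m + m) (fun i => mvar R (eg i))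
  (fun i => mvar R (dg i) * mvar R (dg (ordS i))) j l T (rescale n delta P)
  good_point edge_norm (fun y i => acos (cycle_subst y ord0 i)) Tmon Tsize Troot jl_uniq.
- exact: good_point_dense.
- have [xK ss ltpi] := in_range_acos yr.
  have egE i : y ord0 (eg i) = edge_norm y i * cycle_subst y ord0 i.
    by rewrite mxE mulrC divfK // gt_eqF // edge_norm_gt0.
  split=> // [i|th' fl].
    rewrite jl_mem => io; rewrite edge_norm_gt0 // xK // peX egE; split=> //.
    by rewrite rmorphM /= !peX sqr_sqrtr // mulr_ge0 // ltW.
  rewrite prod_edge_list big_edge_list prod_edge_norm // [edge_norm y o * _]mulrC -mulrA.
  rewrite map_rescale horner_rescale ?(leq_trans (size_poly _ _)) //.
  rewrite horner_map_in_var.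
  rewrite [X in _ * X](_ : _ = 0) ?mulr0 //.
  rewrite -[RHS](boundary_angles m3 o p0 (t := fun i => Num.sqrt (y ord0 (dg i))) th') => [|i]; last first.
    by rewrite sqrtr_gt0.
  congr (pe _ p); apply/rowP => k; rewrite updE; case: (split_ordP k) => i ->.
    by rewrite -/(dg i) dg_eg planar_point_dg sqr_sqrtr // ltW.
  rewrite -/(eg i) eg_eq planar_point_eg -sqrtrM ?(ltW (y0 i)) // -/(edge_norm y i) /close_angles.
  case: eqVneq => [->|io]; first by [].
  by rewrite egE; case: (fl i) => ->; rewrite ?cosN xK.
exists n, K.[mvar R (eg o) * delta].
(* Evaluating at [delta * s_(o,o+1)] undoes the rescaling up to [delta ^+ n]. *)
have := congr1 (horner^~ (mvar R (eg o) * delta)) pK; rewrite /= hornerM => <-.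
by rewrite [mvar R _ * _]mulrC horner_rescale // horner_in_var.
Qed.

Variable T1 : {poly mvpoly m R}.
Hypothesis HT1 : is_cos_sum_poly (fun i => mvar R i) (fun=> 1) T1.

(** The power [2 ^ size l] of the norm of [o] times [delta]: one factor per root. The exponent is
    even as [l] is nonempty, so no square root remains. *)
Definition clearing_monomial : mvpoly (m + m) R :=
  (mvar R (dg o) * mvar R (dg (ordS o))) ^+ (2 ^ (size l).-1) * delta ^+ (2 ^ size l).

Lemma cone_poly_subst (y : 'rV[R]_(m + m)) : good_point y ->
  pe y cone_poly = pe y clearing_monomial * pe (cycle_subst y) T1.[mvar R o].
Proof.
move=> [y0 yr]; have [rs [rs_size _ rsP]] := cos_sum_poly_split yr.
have egE i : y ord0 (eg i) = edge_norm y i * cycle_subst y ord0 i.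
  by rewrite mxE mulrC divfK // gt_eqF // edge_norm_gt0.
have T1E := rsP _ _ _ _ HT1 (cycle_subst y) (fun=> 1).
have TE := rsP _ _ _ _ HT y (edge_norm y).
rewrite /cone_poly !pe_horner TE => [|i _]; last first.
  rewrite edge_norm_gt0 // peX egE; split=> //.
  by rewrite rmorphM /= !peX sqr_sqrtr // mulr_ge0 // ltW.
rewrite T1E => [|i _]; last by rewrite ltr01 peX rmorph1 mul1r expr1n.
rewrite big1_eq prod_edge_norm // !horner_prod rmorphM /= !peX egE.
set x := cycle_subst y ord0 o; set r := edge_norm y o; set d := pe y delta.
have -> : pe y clearing_monomial = (r * d) ^+ size rs.
  rewrite rmorphM !rmorphXn rmorphM /= !peX -/d rs_size [(r * d) ^+ _]exprMn; congr (_ * _).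
  have -> : (2 ^ size l = 2 * 2 ^ (size l).-1)%N.
    by rewrite -expnS prednK // size_l; move: m2; clear; lia.
  by rewrite exprM sqr_sqrtr // mulr_ge0 // ltW.
have constE (s : seq R) (a : R) : a ^+ size s = \prod_(z <- s) a.
  by elim: s => [|z s IH]; rewrite ?big_nil // big_cons -IH exprS.
rewrite constE -big_split /=; apply: eq_bigr => z _.
rewrite !hornerE; ring.
Qed.

Lemma homogeneous_cycle_poly_rel (G Q : mvpoly (m + m) R) (G' : mvpoly m R) :
  is_cycle_polynomial G' ->
  (forall s : 'rV[R]_(m + m), (forall i : 'I_m, 0 < s ord0 (dg i)) ->
      peval G s = peval Q s * peval G' (cycle_subst s)) ->
  exists2 c, c != 0 & G * clearing_monomial = mpoly.mpolyC (m + m) c * Q * cone_poly.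
Proof.
move=> /(cycle_polynomial_assoc HT1)[c c0 G'E] GQ; exists c => //.
apply/eqP; rewrite -subr_eq0; apply/eqP/good_point_dense => y yg.
have := cone_poly_subst yg; move: clearing_monomial cone_poly => M F FE.
rewrite rmorphB !rmorphM /= peC FE [pe y G]peE (GQ _ yg.1) -!peE G'E rmorphM /= peC.
ring.
Qed.

End Homogeneous.

End CyclePolynomial.

(** * Division by variables *)

Section VariableDivision.
Variables (R : realType) (n : nat).
Implicit Types (p q : mvpoly n R) (v : 'I_n).

Definition zero_at v : {rmorphism mvpoly n R -> mvpoly n R} :=
  psubst (fun k => if k == v then 0 else mvar R k).

Lemma zero_at_mvar v : zero_at v (mvar R v) = 0.
Proof. by rewrite psubstX eqxx. Qed.

Lemma pe_zero_at v x p : pe x (zero_at v p) = pe (upd v 0 x) p.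
Proof.
rewrite pe_psubst; congr (pe _ p); apply/rowP => k; rewrite !mxE.
by case: ifP; rewrite ?rmorph0 ?peX.
Qed.

Lemma mvar_dvd v p : zero_at v p = 0 -> exists K, p = K * mvar R v.
Proof.
move=> p0; have [|q q0|y _|K pK] := @monic_dvd R n 'X (in_var v p) (fun=> True) (fun=> [:: 0]).
- exact: monicX.
- by apply: pe_eq0 => y; apply: q0.
- split; rewrite ?size_polyX // => z; rewrite inE => /eqP ->.
  by rewrite map_polyX hornerX horner_map_in_var -pe_zero_at p0 rmorph0.
exists K.[mvar R v]; have := congr1 (horner^~ (mvar R v)) pK.
by rewrite /= horner_in_var hornerM hornerX.
Qed.

Lemma mvar_not_unit v : mvar R v \isn't a GRing.unit.
Proof.
apply/negP => /(rmorph_unit (zero_at v)); rewrite zero_at_mvar unitr0 //.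
Qed.

(** Variables are prime: each one dividing [p * w] but not [p] divides [w]. *)
Lemma mvar_prod_cancel (s : seq 'I_n) p q w : (forall v, v \in s -> zero_at v p != 0) ->
  (\prod_(v <- s) mvar R v) * q = p * w -> exists w', q = p * w'.
Proof.
elim: s w => [w _|v s IH w ps]; first by rewrite big_nil mul1r => ->; exists w.
rewrite big_cons -mulrA => E.
have : zero_at v (p * w) = 0 by rewrite -E rmorphM /= zero_at_mvar mul0r.
rewrite rmorphM /= => /eqP; rewrite mulf_eq0 (negbTE (ps v (mem_head _ _))) => /eqP /mvar_dvd[K wK].
apply: (IH K); first by move=> k ks; apply: ps; rewrite inE ks orbT.
have X0 : mvar R v != 0.
  by apply: contraNneq (mvar_not_unit v) => E0; have := congr1 (pe (const_mx 1)) E0;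
    rewrite peX mxE rmorph0 => /eqP; rewrite oner_eq0.
by apply: (mulfI X0); rewrite E wK; ring.
Qed.

Lemma mvar_prod_strip (P : pred 'I_n) p : p != 0 -> exists s p',
  [/\ p = (\prod_(v <- s) mvar R v) * p', all P s & forall v, P v -> zero_at v p' != 0].
Proof.
have [k] := ubnP (mpoly.msize p); elim: k p => // k IH p; rewrite ltnS => pk p0.
have [/existsP[v /andP[Pv /eqP /mvar_dvd[K pK]]]|none] := boolP [exists v, P v && (zero_at v p == 0)].
  have K0 : K != 0 by apply: contraNneq p0 => K0; rewrite pK K0 mul0r.
  have X0 : mvar R v != 0 by apply: contraNneq p0 => X0; rewrite pK X0 mulr0.
  have [|s [p' [KE sP p'P]]] := IH K _ K0.
    apply: leq_trans pk; rewrite pK mpoly.msizeM // mpoly.msizeX mpoly.mdeg1 addn2 //.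
  exists (v :: s), p'; split=> //=; last by rewrite Pv.
  by rewrite big_cons pK KE; ring.
exists [::], p; rewrite big_nil mul1r; split=> // v Pv.
by apply: contra none => v0; apply/existsP; exists v; rewrite Pv.
Qed.

Lemma pline_exists (h : 'I_n -> {poly R}) : {f : {rmorphism mvpoly n R -> {poly R}} |
  (forall c, f (mpoly.mpolyC n c) = c%:P) /\ (forall i, f (mvar R i) = h i)}.
Proof.
exists (mpoly.mmap (@polyC R) h : {rmorphism _ -> _}).
by split=> [c|i] /=; rewrite ?mpoly.mmapC // mpoly.mmapX mpoly.mmap1U.
Qed.

Lemma pe_curve (h : 'I_n -> {poly R}) p :
  exists q : {poly R}, forall t, q.[t] = pe (\row_i (h i).[t]) p.
Proof.
have [f [fC fX]] := pline_exists h; exists (f p) => t.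
elim/mvpoly_ind: p => [c|i|p q IHp IHq|p q IHp IHq].
- by rewrite fC hornerC peC.
- by rewrite fX peX mxE.
- by rewrite !rmorphD hornerD IHp IHq.
- by rewrite !rmorphM hornerM IHp IHq.
Qed.

End VariableDivision.

(* Multiplying by a large power of [t], the right-hand side becomes a
   polynomial of too small a degree. *)
Lemma poly_inverse_zero (R : realType) (g h : {poly R}) (u : R) :
  (forall t, 0 < t -> t ^+ 2 * g.[t] = u * h.[t^-1]) -> u * h.[1] = 0.
Proof.
move=> gh; pose d := size h.
pose r : {poly R} := \sum_(k < d) (u * h`_k) *: 'X^(d - k).
have rE : 'X^(d + 2) * g = r.
  apply/eqP; rewrite -subr_eq0; apply/eqP/(@poly_itv0 _ _ 1 2); first by rewrite ltr1n.
  move=> t /andP[t1 _]; have t0 : 0 < t := lt_le_trans ltr01 t1.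
  rewrite hornerD hornerN hornerM hornerXn exprD -mulrA gh // horner_coef horner_sum.
  apply/eqP; rewrite subr_eq0; apply/eqP; rewrite !mulr_sumr; apply: eq_bigr => k _.
  rewrite hornerZ hornerXn exprVn.
  have -> : t ^+ d = t ^+ (d - k) * t ^+ k by rewrite -exprD subnK // ltnW.
  by field; rewrite expf_neq0 // gt_eqF.
have size_r : (size r <= d.+1)%N.
  apply: (leq_trans (size_sum _ _ _)); apply/bigmax_leqP => k _.
  by apply: (leq_trans (size_scale_leq _ _)); rewrite size_polyXn ltnS leq_subr.
have g0 : g = 0.
  apply: contraTeq size_r => g0; rewrite -ltnNge -rE.
  by rewrite mulrC size_mulXn // addnC; move: g0; rewrite -size_poly_gt0; lia.
by have := gh 1 ltr01; rewrite g0 horner0 mulr0 invr1.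
Qed.

Arguments zero_at {R n} v.

(** * Diagonal monomials and the final divisibility *)

Section Homogeneity.
Variables (R : realType) (m : nat).
Hypothesis m3 : (3 < m)%N.
Local Notation dgmon s := (\prod_(v <- s) mvar R v).
Local Notation is_dg := (fun v : 'I_(m + m) => (v < m)%N).

Let m1 : (1 < m)%N := ltnW (ltnW m3).

Lemma dg_of_lt (v : 'I_(m + m)) : (v < m)%N -> exists i, v = dg i.
Proof. by move=> vm; exists (Ordinal vm); apply: val_inj. Qed.

(* Let [s_ii = t^2] tend to [0]: the right-hand side of [G = Q G'] has at worst
   a pole there, whereas the left-hand side has a zero. *)
Lemma dg_not_dvd (i : 'I_m) (K : mvpoly (m + m) R) (G' : mvpoly m R) (u : R) (s : seq 'I_(m + m)) :
  G' != 0 -> u != 0 -> all is_dg s -> dg i \notin s ->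
  (forall y : 'rV[R]_(m + m), (forall i : 'I_m, 0 < y ord0 (dg i)) ->
    pe y (K * mvar R (dg i)) =
      pe y (mpoly.mpolyC (m + m) u * dgmon s) * pe (cycle_subst y) G') -> False.
Proof.
move=> G'0 u0 s_dg si KQ.
have [z [_ zG']] : exists z : 'rV[R]_m, (forall i, 0 <= z ord0 i <= 1) /\ pe z G' != 0.
  by apply: (pe_box_neq0 (a := fun=> 0) (b := fun=> 1)).
(* With all other diagonal entries equal to 1, only the two edges at [i] are divided by [t]; hence
   [h] is evaluated at [t^-1]. *)
have [h hE] := pe_curve (fun k => (z ord0 k)%:P * (if (k == i) || (ordS k == i) then 'X else 1)) G'.
have [g gE] := pe_curve (fun k => match fintype.split k with
   | inl k => if k == i then 'X^2 else 1 | inr k => (z ord0 k)%:P end) K.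
have [] : u * h.[1] != 0 /\ u * h.[1] = 0; last by move=> /eqP.
split.
  rewrite mulf_neq0 // hE; apply: contra zG' => /eqP <-; apply/eqP; congr (pe _ G').
  by apply/rowP => k; rewrite mxE; case: ifP => _; rewrite !hornerE.
apply: (@poly_inverse_zero R g) => t t0.
pose y : 'rV[R]_(m + m) := \row_k (match fintype.split k with
   | inl k => if k == i then 'X^2 else 1 | inr k => (z ord0 k)%:P end : {poly R}).[t].
have yd k : y ord0 (dg k) = if k == i then t ^+ 2 else 1.
  by rewrite mxE (unsplitK (inl k)); case: ifP; rewrite !hornerE.
have ye k : y ord0 (eg k) = z ord0 k by rewrite mxE (unsplitK (inr k)) hornerC.
have y0 k : 0 < y ord0 (dg k) by rewrite yd; case: ifP => _; rewrite ?exprn_gt0.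
have := KQ y y0; rewrite !rmorphM /= peX yd eqxx -gE peC rmorph_prod /= big1_seq => [|k /andP[_ ks]].
  rewrite mulr1 mulrC => ->; congr (_ * _); rewrite hE; congr (pe _ G').
  apply/rowP => k; rewrite [LHS]mxE [RHS]mxE ye !yd.
  have [->|ki] := eqVneq k i.
    rewrite (negbTE (ordS_neq i m1)) mulr1 sqrtr_sqr gtr0_norm // !hornerE.
    by [].
  case: eqVneq => [Ski|Ski]; rewrite mul1r ?sqrtr_sqr ?gtr0_norm // ?sqrtr1 !hornerE //.
  by rewrite invr1 mulr1.
rewrite peX; have [l E] := dg_of_lt (allP s_dg k ks); rewrite E yd.
by case: eqVneq ks => // El; rewrite E El (negbTE si).
Qed.

Definition is_dgmon (p : mvpoly (m + m) R) := exists2 s : seq 'I_(m + m), all is_dg s & p = dgmon s.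

Lemma is_dgmon_dg i : is_dgmon (mvar R (dg i)).
Proof. by exists [:: dg i]; rewrite ?big_seq1 //= ltn_ord. Qed.

Lemma is_dgmonM p q : is_dgmon p -> is_dgmon q -> is_dgmon (p * q).
Proof.
by move=> [s ps ->] [s' ps' ->]; exists (s ++ s'); rewrite ?all_cat ?ps // big_cat.
Qed.

Lemma is_dgmon1 : is_dgmon 1.
Proof. by exists [::]; rewrite ?big_nil. Qed.

Lemma is_dgmonX p n : is_dgmon p -> is_dgmon (p ^+ n).
Proof.
move=> pm; elim: n => [|n IH]; first by rewrite expr0; apply: is_dgmon1.
by rewrite exprS; apply: is_dgmonM.
Qed.

Lemma is_dgmon_delta o : is_dgmon (delta R o).
Proof.
apply: big_ind => [||i _]; [exact: is_dgmon1 | exact: is_dgmonM | exact: is_dgmon_dg].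
Qed.

Lemma is_dgmon_clearing o (l : seq 'I_m) : is_dgmon (clearing_monomial R o l).
Proof.
apply: is_dgmonM; apply: is_dgmonX; last exact: is_dgmon_delta.
by apply: is_dgmonM; apply: is_dgmon_dg.
Qed.

Lemma is_dgmon_cancel M p q w : is_dgmon M -> (forall i, zero_at (dg i) p != 0) ->
  M * q = p * w -> exists w', q = p * w'.
Proof.
move=> [s s_dg ->] p0; apply: mvar_prod_cancel => v vs.
by have [i ->] := dg_of_lt (allP s_dg v vs).
Qed.

Lemma boundary_vanishing_dvd (G P : mvpoly (m + m) R) : is_homogeneous_cycle_polynomial G ->
  vanishing_ideal (@cycle_cone_boundary R m) P -> pdivides (cycle_boundary_polynomial G) P.
Proof.
move=> [G' [G'cp [Q [Q0 cop GQ]]]] P0.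
pose o : 'I_m := Ordinal (ltnW m1); have o0 : val o = 0%N by [].
have [j [l [jl_uniq jl_path jl_mem size_l]]] := edge_list m3 o0.
have [T1 HT1] := cos_sum_poly R (fun i => mvar R i) (fun=> 1 : mvpoly m R) j l.
have [T HT] := cos_sum_poly R (fun i => mvar R (eg i))
  (fun i => mvar R (dg i) * mvar R (dg (ordS i))) j l.
have [c c0 G'E] := cycle_polynomial_assoc o0 jl_uniq jl_path jl_mem HT1 G'cp.
have [c1 c10 rel] := homogeneous_cycle_poly_rel m3 o0 jl_uniq jl_path jl_mem size_l HT HT1 G'cp GQ.
have [n [K PK]] := boundary_cone_poly_dvd m3 o0 jl_uniq jl_path jl_mem HT P0.
have {}GQ (y : 'rV[R]_(m + m)) : (forall i : 'I_m, 0 < y ord0 (dg i)) ->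
    pe y G = pe y Q * pe (cycle_subst y) G' by move=> y0; rewrite !peE GQ.
(* [Q] turns out to be a diagonal monomial up to a constant: the remaining factor [Q'] divides [G]
   after cancellation, so coprimality makes it a unit. *)
have [s [Q' [QE s_dg Q'0]]] := mvar_prod_strip is_dg Q0.
have {}Q'0 i : zero_at (dg i) Q' != 0 by apply: Q'0; rewrite /= ltn_ord.
move: rel PK (is_dgmon_clearing o l) (is_dgmonX n (is_dgmon_delta o)).
move: (clearing_monomial R o l) (cone_poly o T) (delta R o ^+ n) => M F D rel PK Mmon Dmon.
have [W GW] : exists W, G = Q' * W.
  apply: (is_dgmon_cancel Mmon Q'0 (w := mpoly.mpolyC _ c1 * dgmon s * F)).
  by rewrite mulrC rel QE; ring.
have /unit_const[u u0 Q'u] : Q' \is a GRing.unit.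
  by apply: cop; [exists W; rewrite GW mulrC | exists (dgmon s); exact: QE].
rewrite {Q' Q'0 GW}Q'u in QE.
have G'0 : G' != 0 by case: G'cp => -[].
(* A diagonal variable dividing [G] either divides [Q] too, against coprimality, or contradicts
   [dg_not_dvd]. *)
have G0 i : zero_at (dg i) G != 0.
  apply/eqP => /mvar_dvd[K' GK'].
  have [si|si] := boolP (dg i \in s); last first.
    apply: (dg_not_dvd (K := K') G'0 u0 s_dg si) => y y0.
    by rewrite -GK' GQ // QE [mpoly.mpolyC _ u * _]mulrC.
  have /negP[] := mvar_not_unit R (dg i); apply: cop; first by exists K'.
  by rewrite QE (big_rem _ si) /= -mulrA mulrC; eexists.
have [W' PW'] : exists W', P = G * W'.
  have smon : is_dgmon (dgmon s) by exists s.
  apply: (is_dgmon_cancel (is_dgmonM smon Dmon) G0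
    (w := mpoly.mpolyC _ (c1 * u)^-1 * (M * K))).
  rewrite -mulrA PK.
  have -> : G * (mpoly.mpolyC (m + m) (c1 * u)^-1 * (M * K)) =
      mpoly.mpolyC (m + m) (c1 * u)^-1 * (G * M) * K by ring.
  rewrite rel QE.
  have -> : mpoly.mpolyC (m + m) (c1 * u)^-1 * (mpoly.mpolyC (m + m) c1 *
      (dgmon s * mpoly.mpolyC (m + m) u) * F) * K =
      mpoly.mpolyC (m + m) (c1 * u)^-1 * (mpoly.mpolyC (m + m) c1 * mpoly.mpolyC (m + m) u) *
      (dgmon s * (K * F)) by ring.
  by rewrite -!mpoly.mpolyCM mulVf ?mulf_neq0 // mpoly.mpolyC1 mul1r.
(* With unit diagonal and [x_i = 1], the point lies on the minor and is fixed by [minor_pt]; [G] is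
   nonzero there for a suitable choice of the other entries. *)
have minorG i : minor_map R i G != 0.
  have [z [zi zT]] := cycle_polynomial_neq0_at_one o0 jl_uniq jl_path jl_mem HT1 i.
  pose x : 'rV[R]_(m + m) := row_mx (const_mx 1) z.
  have xd k : x ord0 (dg k) = 1 by rewrite row_mxEl mxE.
  have xe k : x ord0 (eg k) = z ord0 k by rewrite row_mxEr.
  apply/eqP => /(congr1 (pe x)); rewrite rmorph0 pe_minor_map.
  have -> : minor_pt i x = x.
    apply/rowP => k; rewrite [LHS]mxE; case: eqP => [->|_]; first by rewrite !xd xe zi mul1r.
    by case: ifP => // /orP[] /eqP ->; rewrite xd expr1n.
  rewrite GQ => [|k]; last by rewrite xd.
  have -> : cycle_subst x = z by apply/rowP => k; rewrite mxE xe !xd mulr1 sqrtr1 divr1.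
  rewrite QE G'E !rmorphM /= !peC rmorph_prod /= big1_seq => [|v /andP[_ vs]]; last first.
    by have [k ->] := dg_of_lt (allP s_dg v vs); rewrite peX xd.
  by move/eqP; rewrite mul1r !mulf_eq0 (negbTE u0) (negbTE c0) (negbTE zT).
have [|K' W'K'] := @prod_minors_dvd _ _ m3 (index_enum 'I_m) W' (index_enum_uniq _).
  move=> i _; have := boundary_minor_map m3 i P0; rewrite PW' rmorphM /= => /eqP.
  by rewrite mulf_eq0 (negbTE (minorG i)) => /eqP.
by exists K'; rewrite PW' W'K' /cycle_boundary_polynomial mulrCA.
Qed.

End Homogeneity.

Theorem theorem4p8 (R : realType) (m : nat) (G : mvpoly (m + m) R) :
  (4 <= m)%N ->
  is_homogeneous_cycle_polynomial G ->
  zariski_closure_defined_by (@cycle_cone_boundary R m)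
    (cycle_boundary_polynomial G).
Proof.
move=> m3 Ghom; pose o : 'I_m := Ordinal (ltnW (ltnW (ltnW m3))).
have Hvan := boundary_polynomial_vanishes m3 (erefl (val o)) Ghom.
have idealE : vanishing_ideal (@cycle_cone_boundary R m) =
    principal_ideal (cycle_boundary_polynomial G).
  apply/seteqP; split=> P; first exact: (boundary_vanishing_dvd m3 Ghom).
  move=> [K ->] s /Hvan H0.
  by rewrite -peE rmorphM /= !peE H0 mulr0.
split=> //; apply/seteqP; split=> s /=.
  by apply.
move=> H0 P; rewrite idealE => -[K ->].
by rewrite -peE rmorphM /= !peE H0 mulr0.
Qed.
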